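(* Let $p$ be an odd prime and let $G$ be a non-abelian $p$-group of order $p^4$ in the isoclinism family $\Phi_2$, i.e. $G$ is one of the six groups below. For each $\mu\in\mathrm{Irr}(Z(G)\mid G')$ let $H\le G$ and the linear character $\psi_\mu$ of $H$ be as listed: (a) $\Phi_2(211)a=\langle \alpha, \alpha_1, \alpha_2, \alpha_3 : [\alpha_1, \alpha]=\alpha^p=\alpha_2,\ \alpha_1^p=\alpha_2^p=\alpha_3^p=1\rangle$; $Z(G)=\langle\alpha^p,\alpha_3\rangle$, $G'=\langle\alpha^p\rangle$; $H=\langle\alpha^p,\alpha_1,\alpha_3\rangle$; $\psi_\mu(\alpha^p)=\mu(\alpha^p)$, $\psi_\mu(\alpha_1)=1$, $\psi_\mu(\alpha_3)=\mu(\alpha_3)$. (b) $\Phi_2(1^4)=\langle \alpha, \alpha_1, \alpha_2, \alpha_3 : [\alpha_1, \alpha]=\alpha_2,\ \alpha^p=\alpha_1^p=\alpha_2^p=\alpha_3^p=1\rangle$; $Z(G)=\langle\alpha_2,\alpha_3\rangle$, $G'=\langle\alpha_2\rangle$; $H=\langle\alpha,\alpha_2,\alpha_3\rangle$; $\psi_\mu(\alpha)=1$, $\psi_\mu(\alpha_2)=\mu(\alpha_2)$, $\psi_\mu(\alpha_3)=\mu(\alpha_3)$. (c) $\Phi_2(31)=\langle \alpha, \alpha_1, \alpha_2 : [\alpha_1, \alpha]=\alpha^{p^2}=\alpha_2,\ \alpha_1^p=\alpha_2^p=1\rangle$; $Z(G)=\langle\alpha^p\rangle$, $G'=\langle\alpha^{p^2}\rangle$;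 $H=\langle\alpha^p,\alpha_1\rangle$; $\psi_\mu(\alpha^p)=\mu(\alpha^p)$, $\psi_\mu(\alpha_1)=1$. (d) $\Phi_2(22)=\langle \alpha, \alpha_1, \alpha_2 : [\alpha_1, \alpha]=\alpha^p=\alpha_2,\ \alpha_1^{p^2}=\alpha_2^p=1\rangle$; $Z(G)=\langle\alpha^p,\alpha_1^p\rangle$, $G'=\langle\alpha^p\rangle$; $H=\langle\alpha^{-i}\alpha_1,\alpha^p\rangle$, where $0\le i\le p-1$ is determined by $\mu(\alpha_1^p)=\mu(\alpha^p)^i$; $\psi_\mu(\alpha^{-i}\alpha_1)=1$, $\psi_\mu(\alpha^p)=\mu(\alpha^p)$. (e) $\Phi_2(211)b=\langle \alpha, \alpha_1, \alpha_2, \gamma : [\alpha_1, \alpha]=\gamma^p=\alpha_2,\ \alpha^p=\alpha_1^p=\alpha_2^p=1\rangle$; $Z(G)=\langle\gamma\rangle$, $G'=\langle\gamma^p\rangle$; $H=\langle\alpha_1,\gamma\rangle$; $\psi_\mu(\alpha_1)=1$, $\psi_\mu(\gamma)=\mu(\gamma)$. (f) $\Phi_2(211)c=\langle \alpha, \alpha_1, \alpha_2 : [\alpha_1, \alpha]=\alpha_2,\ \alpha^{p^2}=\alpha_1^p=\alpha_2^p=1\rangle$; $Z(G)=\langle\alpha^p,\alpha_2\rangle$, $G'=\langle\alpha_2\rangle$; $H=\langle\alpha^p,\alpha_1,\alpha_2\rangle$; $\psi_\mu(\alpha^p)=\mu(\alpha^p)$, $\psi_\mu(\alpha_1)=1$,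 $\psi_\mu(\alpha_2)=\mu(\alpha_2)$. Then in each case $(H,\psi_\mu)$ is a special required pair for an irreducible rational matrix representation of $G$ affording $\Omega(\chi_\mu)$. Consequently these pairs determine all inequivalent irreducible rational matrix representations of $G$ whose kernels do not contain $G'$: every such representation is equivalent to $\Psi_\mu^G$ for some $\mu\in\mathrm{Irr}(Z(G)\mid G')$, where $\Psi_\mu$ is an irreducible $\mathbb{Q}$-representation of $H$ affording $\Omega(\psi_\mu)$, and $\Psi_\mu^G$ affords $\Omega(\chi_\mu)$.
   Context: In the presentations, all commutators of pairs of generators that are not listed are trivial; $[x,y]=x^{-1}y^{-1}xy$. $\Phi_2$ is the isoclinism family (in James' classification) consisting of the groups of order $p^4$ of nilpotency class $2$; the six listed groups are all of them. For such $G$, $\mathrm{Irr}(Z(G)\mid G')=\{\mu\in\mathrm{Irr}(Z(G)) : G'\not\subseteq\ker\mu\}$, and the non-linear irreducible complex characters of $G$ are exactly the $\chi_\mu$, $\mu\in\mathrm{Irr}(Z(G)\mid G')$, with $\chi_\mu(g)=p\mu(g)$ for $g\in Z(G)$ and $\chi_\mu(g)=0$ otherwise. For an irreducible complex character $\chi$, $\Omega(\chi)=m_{\mathbb{Q}}(\chi)\sum_{\sigma\in\mathrm{Gal}(\mathbb{Q}(\chi)/\mathbb{Q})}\chi^\sigma$, where $m_{\mathbb{Q}}(\chi)$ is the Schur index over $\mathbb{Q}$ (equal to $1$ for $p$-groups with $p$ odd) and $\mathbb{Q}(\chi)$ is the field of character values; it is the character of an irreducible $\mathbb{Q}$-representation.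 For $\chi\in\mathrm{Irr}(G)$ with $m_{\mathbb{Q}}(\chi)=1$, a special required pair for an irreducible rational matrix representation affording $\Omega(\chi)$ is a pair $(H,\psi)$ with $H\le G$, $\psi$ a linear character of $H$, $\psi^G=\chi$ and $\mathbb{Q}(\psi)=\mathbb{Q}(\chi)$. $\psi^G$, $\Psi^G$ denote induction to $G$. *)

(* Defs.v *)
From HB Require Import structures.
From mathcomp Require Import all_boot all_order all_algebra all_fingroup.
From mathcomp Require Import all_solvable all_field all_character.
From Stdlib Require Import ClassicalEpsilon.

Set Implicit Arguments.
Unset Strict Implicit.
Unset Printing Implicit Defensive.

Import Order.TTheory GRing.Theory Num.Theory.
Local Open Scope group_scope.
Local Open Scope ring_scope.

(* A presentation as a closed term, so that the same one can be used with     *)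
(* \isog Grp and with a named family of generators. MathComp's commutator     *)
(* [~ x, y] is x^-1 * y^-1 * x * y.                                           *)
Notation "'Pres' ( x : p )" :=
  ((fun x => Presentation.Cast p) : Presentation.term -> Presentation.type)
  (x name, p custom group_presentation at level 200, only parsing).

Definition Phi2_211a (p : nat) := Pres (
  x : x1 : x2 : x3 :
    [~ x1, x] = x^+p = x2, x1^+p, x2^+p, x3^+p,
    [~ x, x2], [~ x, x3], [~ x1, x2], [~ x1, x3], [~ x2, x3]).

Definition Phi2_1111 (p : nat) := Pres (
  x : x1 : x2 : x3 :
    [~ x1, x] = x2, x^+p, x1^+p, x2^+p, x3^+p,
    [~ x, x2], [~ x, x3], [~ x1, x2], [~ x1, x3], [~ x2, x3]).

Definition Phi2_31 (p : nat) := Pres (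
  x : x1 : x2 :
    [~ x1, x] = x^+(p ^ 2)%N = x2, x1^+p, x2^+p,
    [~ x, x2], [~ x1, x2]).

Definition Phi2_22 (p : nat) := Pres (
  x : x1 : x2 :
    [~ x1, x] = x^+p = x2, x1^+(p ^ 2)%N, x2^+p,
    [~ x, x2], [~ x1, x2]).

Definition Phi2_211b (p : nat) := Pres (
  x : x1 : x2 : y :
    [~ x1, x] = y^+p = x2, x^+p, x1^+p, x2^+p,
    [~ x, x2], [~ x, y], [~ x1, x2], [~ x1, y], [~ x2, y]).

Definition Phi2_211c (p : nat) := Pres (
  x : x1 : x2 :
    [~ x1, x] = x2, x^+(p ^ 2)%N, x1^+p, x2^+p,
    [~ x, x2], [~ x1, x2]).

(* The elements of s satisfy the relations of a presentation; n counts the    *)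
(* generators already instantiated, and size s must be their total number.    *)
Fixpoint satisfies (gT : finGroupType) (s : seq gT) (n : nat)
    (q : Presentation.type) : bool :=
  match q with
  | Presentation.Formula f =>
      (size s == n) && Presentation.rel s f Presentation.NoRel
  | Presentation.Generator q' => satisfies s n.+1 (q' (Presentation.Cst n))
  end.

Definition presents (gT : finGroupType) (G : {group gT})
    (q : Presentation.term -> Presentation.type) (s : seq gT) : Prop :=
  [/\ G \isog Grp q, <<[set x in s]>> = G
    & satisfies s 1 (q (Presentation.Cst 0))].

(* A number field, Galois over rat, with an embedding in algC whose image     *)
(* contains all values of characters of G.                                    *)
Definition ambient_field (gT : finGroupType) (G : {group gT}) :
  splittingFieldType rat := tag2 (group_num_field_exists G).

Definition ambient_embed (gT : finGroupType) (G : {group gT}) :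
  {rmorphism ambient_field G -> algC} :=
  tag (tagged2' (group_num_field_exists G)).

(* The (unique) preimage of phi x in the ambient field, when there is one.    *)
Definition cfval_in (gT : finGroupType) (G : {group gT}) (phi : 'CF(G))
    (x : gT) : ambient_field G :=
  epsilon (inhabits 0) (fun a => ambient_embed G a = phi x).

(* Q(phi), as a subfield of the ambient field. *)
Definition charfield (gT : finGroupType) (G : {group gT}) (phi : 'CF(G)) :
  {subfield ambient_field G} :=
  <<1 & [seq cfval_in phi x | x in G]>>%AS.

(* Q(phi), as a subset of the complex numbers. *)
Definition in_charfield (gT : finGroupType) (G : {group gT}) (phi : 'CF(G))
    (z : algC) : Prop :=
  exists2 a, a \in charfield phi & ambient_embed G a = z.

Definition same_charfield (gT : finGroupType) (H G : {group gT})
    (psi : 'CF(H)) (chi : 'CF(G)) : Prop :=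
  forall z, in_charfield psi z <-> in_charfield chi z.

Lemma galconj_subproof (gT : finGroupType) (G : {group gT}) (phi : 'CF(G))
    (s : gal_of (charfield phi)) :
  is_class_fun <<G>> [ffun x => ambient_embed G (s (cfval_in phi x))].
Proof.
rewrite genGid; apply: intro_class_fun => [x y Gx Gy | x notGx].
  by rewrite /cfval_in cfunJ.
suff -> : cfval_in phi x = 0 by rewrite !rmorph0.
have inj_embed := fmorph_inj (ambient_embed G).
apply: inj_embed; rewrite rmorph0.
rewrite /cfval_in cfun0 //.
have ex0 : exists a, ambient_embed G a = 0 by exists 0; rewrite rmorph0.
exact: (epsilon_spec (inhabits 0) _ ex0).
Qed.

Definition galconj (gT : finGroupType) (G : {group gT}) (phi : 'CF(G))
    (s : gal_of (charfield phi)) : 'CF(G) :=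
  Cfun 0 (galconj_subproof s).

(* chi is afforded by a representation over a number field K containing       *)
(* Q(chi) -- the traces force the inclusion -- with [K : Q(chi)] = d.         *)
Definition realized_in_degree (gT : finGroupType) (G : {group gT})
    (chi : 'CF(G)) (d : nat) : Prop :=
  exists (K : fieldExtType rat) (f : {rmorphism K -> algC}) (n : nat)
         (rG : mx_representation K G n),
    cfRepr (map_repr f rG) = chi
    /\ \dim {:K} = (d * \dim (charfield chi))%N.

(* Schur index over the rationals: the least degree [K : Q(chi)] of a field   *)
(* K over which chi is realized.                                              *)
Definition schur_index (gT : finGroupType) (G : {group gT}) (chi : 'CF(G)) :
  nat :=
  epsilon (inhabits 0%N) (fun d =>
    realized_in_degree chi d
    /\ forall d', realized_in_degree chi d' -> (d <= d')%N).

Definition Omega (gT : finGroupType) (G : {group gT}) (chi : 'CF(G)) :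
  'CF(G) :=
  (schur_index chi)%:R *: \sum_(s in 'Gal(charfield chi / 1)) galconj s.

Definition affords (gT : finGroupType) (G : {group gT}) (n : nat)
    (rG : mx_representation rat G n) (phi : 'CF(G)) : Prop :=
  cfRepr (map_repr (@ratr algC) rG) = phi.

(* (H, psi) is a special required pair for the irreducible rational matrix    *)
(* representation rG affording Omega chi.                                     *)
Definition special_required_pair (gT : finGroupType) (G : {group gT})
    (n : nat) (rG : mx_representation rat G n) (chi : 'CF(G))
    (H : {group gT}) (psi : 'CF(H)) : Prop :=
  [/\ chi \in irr G, schur_index chi = 1%N,
      mx_irreducible rG, affords rG (Omega chi)
    & [/\ H \subset G, psi \is a linear_char, 'Ind[G] psi = chi
        & same_charfield psi chi]].

(* Irr(Z(G) | G') *)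
Definition irrZ_over_der (gT : finGroupType) (G : {group gT})
    (mu : 'CF('Z(G))) : Prop :=
  mu \in irr 'Z(G) /\ ~~ (G^`(1)%g \subset cfker mu).

Lemma chi_of_subproof (p : nat) (gT : finGroupType) (G : {group gT})
    (mu : 'CF('Z(G))) :
  is_class_fun <<G>> [ffun x => if x \in 'Z(G)%g then p%:R * mu x else 0].
Proof.
rewrite genGid; apply: intro_class_fun => [x y Gx Gy | x notGx].
  have nZy : y \in 'N('Z(G))%g by apply: subsetP Gy; rewrite gFnorm.
  rewrite memJ_norm //; case: ifP => // Zx; congr (_ * mu _).
  have [_ /centP cGx] := setIP Zx.
  exact/conjg_fixP/commgP/cGx.
by case: ifP => // /setIP[Gx]; rewrite Gx in notGx.
Qed.

(* The class function chi_mu attached to mu, for G of order p^4 and class 2. *)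
Definition chi_of (p : nat) (gT : finGroupType) (G : {group gT})
    (mu : 'CF('Z(G))) : 'CF(G) :=
  Cfun 0 (chi_of_subproof p mu).

Section Induced.

Variables (F : fieldType) (gT : finGroupType) (G H : {group gT}).
Hypothesis sHG : H \subset G.
Variables (n : nat) (rH : mx_representation F H n).

Definition coset_rep (i : 'I_#|rcosets H G|) : gT := repr (enum_val i).

(* With t_i the chosen representatives of the right cosets of H in G, block   *)
(* (i, j) of the induced matrix at g is rH (t_i g t_j^-1) if that element is  *)
(* in H, and 0 otherwise: the matrices act on row vectors, so the induced     *)
(* module is the direct sum of the W t_i, where W is the module of rH.        *)
Definition induced_block (g : gT) (i j : 'I_#|rcosets H G|) : 'M[F]_n :=
  let h := (coset_rep i * g * (coset_rep j)^-1)%g in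
  if h \in H then rH h else 0.

Definition induced_mx (g : gT) : 'M[F]_(\sum_(i < #|rcosets H G|) n) :=
  \mxblock_(i, j) induced_block g i j.

Lemma coset_rep_rcoset i : enum_val i = H :* coset_rep i.
Proof.
have /rcosetsP[x Gx Dx] := enum_valP i.
by rewrite /coset_rep Dx rcoset_repr.
Qed.

Lemma coset_repG i : coset_rep i \in G.
Proof.
have /rcosetsP[x Gx Dx] := enum_valP i.
have: coset_rep i \in H :* x by rewrite /coset_rep Dx mem_repr_rcoset.
by apply/subsetP; rewrite mul_subG ?sub1set.
Qed.

Lemma induced_mx_repr : mx_repr G induced_mx.
Proof.
split=> [|x y Gx Gy].
  rewrite -mxdiagZ /mxdiag; apply: eq_mxblock => i j.
  rewrite /induced_block mulg1 -mem_rcoset conform_mx_id.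
  have -> : (coset_rep i \in H :* coset_rep j) = (i == j).
    rewrite -(inj_eq enum_val_inj) !coset_rep_rcoset.
    by apply/rcoset_eqP/eqP.
  by case: eqP => // ->; rewrite mulgV repr_mx1.
rewrite /induced_mx mul_mxblock; apply: eq_mxblock => i j.
have Hk: H :* (coset_rep i * x) \in rcosets H G.
  by apply/rcosetsP; exists (coset_rep i * x)%g; rewrite ?groupM ?coset_repG.
pose k := enum_rank_in Hk (H :* (coset_rep i * x)).
have Dk: H :* coset_rep k = H :* (coset_rep i * x).
  by rewrite -coset_rep_rcoset enum_rankK_in.
have HkP l : (coset_rep i * x * (coset_rep l)^-1 \in H)%g = (l == k).
  rewrite -mem_rcoset -(inj_eq enum_val_inj) !coset_rep_rcoset Dk eq_sym.
  by apply/rcoset_eqP/eqP.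
rewrite (bigD1 k) //= big1 ?addr0 => [|l neq_lk]; last first.
  by rewrite {1}/induced_block HkP (negPf neq_lk) mul0mx.
have Hh: (coset_rep i * x * (coset_rep k)^-1)%g \in H by rewrite HkP.
rewrite /induced_block Hh.
have Dh : (coset_rep i * (x * y) * (coset_rep j)^-1
   = (coset_rep i * x * (coset_rep k)^-1)
     * (coset_rep k * y * (coset_rep j)^-1))%g.
  by rewrite !mulgA mulgKV.
rewrite Dh groupMl //; case: ifP => Hh'; last by rewrite mulmx0.
by rewrite repr_mxM.
Qed.

Definition induced_repr := MxRepresentation induced_mx_repr.

End Induced.

(* listed mu H psi means that (H, psi) is the pair (H, psi_mu) listed for mu. *)
Definition pairs_determine_irreps (p : nat) (gT : finGroupType)
    (G : {group gT})
    (listed : 'CF('Z(G)) -> forall H : {group gT}, 'CF(H) -> Prop) : Prop :=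
  [/\ forall mu, irrZ_over_der mu ->
        exists (H : {group gT}) (psi : 'CF(H)), listed mu H psi,
      forall mu (H : {group gT}) (psi : 'CF(H)),
        irrZ_over_der mu -> listed mu H psi ->
        exists (n : nat) (rG : mx_representation rat G n),
          special_required_pair rG (chi_of p mu) psi,
      forall mu (H : {group gT}) (psi : 'CF(H)),
        irrZ_over_der mu -> listed mu H psi ->
        exists (m : nat) (Psi : mx_representation rat H m),
          mx_irreducible Psi /\ affords Psi (Omega psi),
      forall mu (H : {group gT}) (psi : 'CF(H)) (sHG : H \subset G)
          (m : nat) (Psi : mx_representation rat H m),
        irrZ_over_der mu -> listed mu H psi ->
        mx_irreducible Psi -> affords Psi (Omega psi) ->
        [/\ mx_irreducible (induced_repr sHG Psi),
            ~~ (G^`(1)%g \subset rker (induced_repr sHG Psi))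
          & affords (induced_repr sHG Psi) (Omega (chi_of p mu))]
    & forall (n : nat) (rG : mx_representation rat G n),
        mx_irreducible rG -> ~~ (G^`(1)%g \subset rker rG) ->
        exists2 mu, irrZ_over_der mu &
          forall (H : {group gT}) (psi : 'CF(H)) (sHG : H \subset G)
              (m : nat) (Psi : mx_representation rat H m),
            listed mu H psi ->
            mx_irreducible Psi -> affords Psi (Omega psi) ->
            mx_rsim rG (induced_repr sHG Psi)].

(* Main.v *)
Require Import Defs.
From mathcomp Require Import all_boot all_order all_algebra all_fingroup.
From mathcomp Require Import all_solvable all_field all_character.
From Stdlib Require Import ClassicalEpsilon.

Set Implicit Arguments.
Unset Strict Implicit.
Unset Printing Implicit Defensive.

Import Order.TTheory GRing.Theory Num.Theory.
Local Open Scope group_scope.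
Local Open Scope ring_scope.

(** Write Z for the centre of G.

    In each family G is generated by two elements x, y and a central set A
    such that [x, y], x^p and y^p lie in <<A>>. As G is not abelian, G / Z is
    not cyclic, and this forces Z = <<A>> with |G : Z| = p^2, while G' is
    generated by [x, y] ([two_generators_center], [two_generators_der1]).

    For such a G, an irreducible character chi whose kernel does not contain
    G' has degree a power of p greater than 1 with square at most |G : Z|, so
    chi has degree p; equality in this bound makes chi vanish off Z, so that
    chi is chi_mu for its central character mu ([nonlinear_irr_chi_of]).
    Let h be an element outside Z with mu(h^p) = 1. Then mu extends to a linear
    character psi of the abelian group H = Z<h> with psi(h) = 1
    ([extend_lin_char]); H has index p, and the induced character of psi, which
    has degree p and contains chi_mu, is chi_mu ([Ind_chi_of]). The values of
    psi are those of mu, so psi and chi_mu have the same field of values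
    ([same_charfield_pair]). In five families h is a generator of order p. In
    the remaining one, p being odd, (a^-i a1)^p = (a^p)^-i a1^p, and i is chosen
    to make mu trivial on this element.

    The rational side rests on one remark ([orbit_sum_constt]): the character of
    a rational representation is fixed by all field automorphisms, so with an
    irreducible constituent chi it contains the sum of the Galois conjugates
    of chi. Fields of character values being abelian over the rationals, that
    sum has as many terms as the degree of the field. Hence
    - a rational representation affording an orbit sum is irreducible
      ([orbit_sum_irreducible]);
    - letting H act on the field of values of psi, by multiplication through
      psi, affords the orbit sum of psi ([charfield_mul_repr_affords]);
    - inducing a representation that affords the orbit sum of psi affords the
      orbit sum of chi_mu ([induced_affords]);
    the last two by comparing degrees. The orbit sums are the characters Omega,
    because psi, and by induction chi_mu, are realized over their common field
    of values, so their Schur indices are 1. Finally two irreducible rational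
    representations whose characters are not orthogonal are isomorphic
    ([affords_rsim]), and an irreducible rational representation whose kernel
    does not contain G' has some chi_mu among its complex constituents. *)

(** * Number fields of character values *)

Lemma ambient_embed_cfval (gT : finGroupType) (G : {group gT}) (phi : 'CF(G))
    x :
  phi \is a character -> ambient_embed G (cfval_in phi x) = phi x.
Proof.
move=> Nphi; rewrite /cfval_in.
apply: (epsilon_spec (inhabits 0%R) (fun a => ambient_embed G a = phi x)).
rewrite /ambient_embed /ambient_field.
have [Gx | notGx] := boolP (x \in G); last first.
  by exists 0%R; rewrite rmorph0 cfun0.
case: (group_num_field_exists G) => Qn ? [QnC ? [w ? valQn]] /=.
by have [a Da] := valQn _ _ _ Nphi x (order_dvdG Gx); exists a.
Qed.

Lemma ambient_galois (gT : finGroupType) (G : {group gT}) :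
  galois 1 {: ambient_field G}.
Proof. by rewrite /ambient_field; case: (group_num_field_exists G). Qed.

(** Galois conjugation has to act on algebraic complex numbers for the theory
    of [cfAut] to apply to [galconj]. *)
Lemma ambient_gal_ext (gT : finGroupType) (G : {group gT})
    (s : gal_of {: ambient_field G}) :
  exists nu : {rmorphism algC -> algC},
    forall a, ambient_embed G (s a) = nu (ambient_embed G a).
Proof.
move: s; rewrite /ambient_embed /ambient_field.
case: (group_num_field_exists G) => Qn ? [QnC nuQ [w ? ?]] /= s.
by have [nu Dnu] := nuQ s; exists nu; apply: Dnu.
Qed.

(** An automorphism is determined by the power of w to which it maps w, and
    raising to powers commutes. *)
Lemma cyclotomic_gal_abelian (F : fieldType) (L : splittingFieldType F)
    (n : nat) (w : L) :
  n.-primitive_root w -> <<1; w>>%VS = {:L}%VS -> abelian 'Gal({:L} / 1).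
Proof.
move=> prim_w gen_w.
have powE (s : gal_of {:L}) : exists k, s w = w ^+ k.
  have: s w ^+ n = 1 by rewrite -rmorphXn prim_expr_order ?rmorph1.
  by case/(prim_rootP prim_w) => k ->; exists k.
have gal1 (s : gal_of {:L}) : s \in 'Gal({:L} / 1).
  by rewrite gal_kHom ?sub1v ?k1AHom.
have eq_gal (u v : gal_of {:L}) : u w = v w -> u == v.
  have := gal1 v; have := gal1 u; move: u v.
  rewrite -gen_w => u v gal_u gal_v.
  by rewrite (gal_adjoin_eq gal_u gal_v) => ->.
apply/centsP=> s _ t _; apply/eqP/eq_gal; rewrite !galM ?memvf //.
have [[i Di] [j Dj]] := (powE s, powE t).
by rewrite Di Dj !rmorphXn /= Di Dj -!exprM mulnC.
Qed.

Lemma ambient_gal_abelian (gT : finGroupType) (G : {group gT}) :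
  abelian 'Gal({: ambient_field G} / 1).
Proof.
rewrite /ambient_field; case: (group_num_field_exists G).
move=> Qn ? [? ? [w [prim_w gen_w] ?]] /=.
exact: cyclotomic_gal_abelian prim_w gen_w.
Qed.

(** Every subgroup of an abelian Galois group is normal; this is what makes the
    number of conjugates of a character equal to the degree of its field. *)
Lemma ambient_subfield_galois (gT : finGroupType) (G : {group gT})
    (K : {subfield ambient_field G}) :
  galois 1 K.
Proof.
have galL := ambient_galois G.
have galLK: galois K {: ambient_field G}.
  by apply: galoisS galL; rewrite sub1v subvf.
rewrite -(galois_fixedField galLK).
apply: (normal_fixedField_galois galL).
have sKL : 'Gal({: ambient_field G} / K) \subset 'Gal({: ambient_field G} / 1).
  by rewrite galS ?sub1v.
rewrite /normal sKL (subset_trans (ambient_gal_abelian G)) //.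
by rewrite (subset_trans (centS sKL)) ?cent_sub.
Qed.

Lemma card_charfield_gal (gT : finGroupType) (G : {group gT}) (phi : 'CF(G)) :
  #|'Gal(charfield phi / 1)| = \dim (charfield phi).
Proof.
by rewrite -(galois_dim (ambient_subfield_galois (charfield phi))) dimv1 divn1.
Qed.

Lemma cfval_charfield (gT : finGroupType) (G : {group gT}) (phi : 'CF(G)) x :
  x \in G -> cfval_in phi x \in charfield phi.
Proof. by move=> Gx; apply/seqv_sub_adjoin/image_f. Qed.

Lemma galconjE (gT : finGroupType) (G : {group gT}) (phi : 'CF(G))
    (s : gal_of (charfield phi)) x :
  x \in G -> galconj s x = ambient_embed G (s (cfval_in phi x)).
Proof. by move=> Gx; rewrite cfunE. Qed.

(** An automorphism of the field of values extends to the ambient field, which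
    is normal, and from there to all algebraic numbers. *)
Lemma galconj_cfAut (gT : finGroupType) (G : {group gT}) (phi : 'CF(G))
    (s : gal_of (charfield phi)) :
  phi \is a character ->
  exists nu : {rmorphism algC -> algC}, galconj s = cfAut nu phi.
Proof.
move=> Nphi; have [_ _ nL] := and3P (ambient_galois G).
have sKL: (1 <= charfield phi <= {: ambient_field G})%VS.
  by rewrite sub1v subvf.
have [t _ st] := kHom_to_gal sKL nL (k1AHom _ s).
have [nu Dnu] := ambient_gal_ext t; exists nu.
apply/cfun_inP=> x Gx; rewrite galconjE // cfunE st ?cfval_charfield // Dnu.
by rewrite ambient_embed_cfval.
Qed.

Lemma galconj1 (gT : finGroupType) (G : {group gT}) (phi : 'CF(G)) :
  phi \is a character -> galconj (1%g : gal_of (charfield phi)) = phi.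
Proof.
move=> Nphi; apply/cfun_inP=> x Gx.
by rewrite galconjE // gal_id ambient_embed_cfval.
Qed.

(** The values generate the field, so an automorphism is determined by what it
    does to them. *)
Lemma galconj_inj (gT : finGroupType) (G : {group gT}) (phi : 'CF(G)) :
  injective (@galconj _ G phi).
Proof.
move=> s t eq_st; apply/eqP; rewrite eq_mulgV1; apply/eqP.
pose u : gal_of (charfield phi) := (s * t^-1)%g; rewrite -[(_ * _)%g]/u.
have /subvP fixE: (charfield phi <= fixedField <[u]>%g)%VS.
  apply/Fadjoin_seqP; split=> [|_ /imageP[x Gx ->]]; first exact: sub1v.
  have Ea := cfval_charfield phi Gx; set a := cfval_in phi x in Ea *.
  have eq_a: s a = t a.
    apply: (fmorph_inj (ambient_embed G)).
    by rewrite -!galconjE // eq_st.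
  have fix_a: u a = a by rewrite galM // eq_a -galM // mulgV gal_id.
  apply/fixedFieldP=> // _ /cycleP[k ->].
  elim: k => [|k IHk]; first by rewrite expg0 gal_id.
  by rewrite expgSr galM // IHk.
apply/eqP/gal_eqP=> a Ea; rewrite gal_id.
by have /fixedFieldP-> := fixE _ Ea; rewrite ?cycle_id.
Qed.

Lemma in_charfieldD (gT : finGroupType) (G : {group gT}) (phi : 'CF(G)) y z :
  in_charfield phi y -> in_charfield phi z -> in_charfield phi (y + z).
Proof.
by case=> a Ea <- [b Eb <-]; exists (a + b); rewrite ?rpredD ?rmorphD.
Qed.

Lemma in_charfieldM (gT : finGroupType) (G : {group gT}) (phi : 'CF(G)) y z :
  in_charfield phi y -> in_charfield phi z -> in_charfield phi (y * z).
Proof.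
by case=> a Ea <- [b Eb <-]; exists (a * b); rewrite ?rpredM ?rmorphM.
Qed.

Lemma in_charfield_rat (gT : finGroupType) (G : {group gT}) (phi : 'CF(G)) r :
  in_charfield phi (ratr r).
Proof.
exists r%:A; first by rewrite rpredZ ?rpred1.
by rewrite alg_num_field fmorph_rat.
Qed.

Lemma in_charfield_cfun (gT : finGroupType) (G : {group gT}) (phi : 'CF(G)) x :
  phi \is a character -> in_charfield phi (phi x).
Proof.
move=> Nphi; have [Gx | notGx] := boolP (x \in G).
  by exists (cfval_in phi x); rewrite ?cfval_charfield ?ambient_embed_cfval.
by rewrite cfun0 // -(rmorph0 (@ratr algC)); apply: in_charfield_rat.
Qed.

(** Comparing fields of values is done inside the complex numbers, because the
    two fields live in ambient fields attached to different groups. Elements of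
    an extension generated by a list are polynomial in its last member. *)
Lemma in_charfield_min (gT hT : finGroupType) (G : {group gT})
    (H : {group hT}) (phi : 'CF(G)) (psi : 'CF(H)) :
    phi \is a character ->
    (forall x, x \in G -> in_charfield psi (phi x)) ->
  forall z, in_charfield phi z -> in_charfield psi z.
Proof.
move=> Nphi phi_psi _ [a + <-]; rewrite /charfield /=.
have: {in [seq cfval_in phi x | x in G],
         forall b, in_charfield psi (ambient_embed G b)}.
  by move=> _ /imageP[x Gx ->]; rewrite ambient_embed_cfval //; apply: phi_psi.
elim/last_ind: [seq _ | _ in _] a => [|rs b IHrs] a psi_rs.
  rewrite Fadjoin_nil => /vlineP[r ->].
  by rewrite alg_num_field fmorph_rat; apply: in_charfield_rat.
rewrite adjoin_rcons => /Fadjoin_polyP[q /polyOverP Kq ->].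
have psi_b: in_charfield psi (ambient_embed G b).
  by apply: psi_rs; rewrite mem_rcons mem_head.
rewrite horner_coef rmorph_sum /=.
apply: (big_ind (in_charfield psi)) => [||i _].
- by rewrite -(rmorph0 (@ratr algC)); apply: in_charfield_rat.
- exact: in_charfieldD.
rewrite rmorphM rmorphXn /=; apply: in_charfieldM.
  by apply: IHrs => // c rs_c; apply: psi_rs; rewrite mem_rcons inE rs_c orbT.
elim: (i : nat) => [|k IHk].
  by rewrite expr0 -(rmorph1 (@ratr algC)); apply: in_charfield_rat.
by rewrite exprS; apply: in_charfieldM.
Qed.

(** A basis of the smaller field, moved to the other ambient field through the
    complex numbers, stays free. *)
Lemma charfield_dim_le (gT hT : finGroupType) (G : {group gT})
    (H : {group hT}) (phi : 'CF(G)) (psi : 'CF(H)) :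
    (forall z, in_charfield phi z -> in_charfield psi z) ->
  (\dim (charfield phi) <= \dim (charfield psi))%N.
Proof.
move=> phi_psi; pose b := vbasis (charfield phi).
have /fin_all_exists2[c Ec Dc] (i : 'I_(\dim (charfield phi))) :
    exists2 d, d \in charfield psi & ambient_embed H d = ambient_embed G b`_i.
  by apply: phi_psi; exists b`_i; rewrite // vbasis_mem ?mem_nth ?size_tuple.
pose X := [tuple c i | i < \dim (charfield phi)].
have free_X: free X.
  have /freeP free_b: free b by apply: basis_free (vbasisP _).
  apply/freeP=> k sum0; apply: free_b.
  apply: (fmorph_inj (ambient_embed G)); rewrite rmorph0.
  rewrite -(rmorph0 (ambient_embed H)) -sum0 !rmorph_sum.
  apply: eq_bigr => i _; rewrite /= !rmorphZ_num.
  by rewrite -(tnth_nth 0 X) tnth_mktuple Dc.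
rewrite -(size_tuple X) -(eqnP free_X); apply/dimvS/span_subvP=> d.
by move=> /tnthP[i ->]; rewrite tnth_mktuple.
Qed.

Lemma same_charfield_dim (gT hT : finGroupType) (G : {group gT})
    (H : {group hT}) (phi : 'CF(G)) (psi : 'CF(H)) :
  (forall z, in_charfield phi z <-> in_charfield psi z) ->
  \dim (charfield phi) = \dim (charfield psi).
Proof.
move=> eqC; apply/eqP; rewrite eqn_leq.
by rewrite !charfield_dim_le // => z /eqC.
Qed.

(** * Galois orbit sums and rational representations *)

Lemma affords_cfAut (gT : finGroupType) (G : {group gT}) (n : nat)
    (rG : mx_representation rat G n) (phi : 'CF(G))
    (nu : {rmorphism algC -> algC}) :
  affords rG phi -> cfAut nu phi = phi.
Proof.
move<-; apply/cfun_inP=> x Gx; rewrite !cfunE Gx !mulr1n.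
by rewrite /= /map_repr_mx trace_map_mx fmorph_rat.
Qed.

(** The Schur indices of the characters considered below are 1, so that this sum
    is their [Omega]; it can be handled before the Schur index is known. *)
Definition orbit_sum (gT : finGroupType) (G : {group gT}) (chi : 'CF(G)) :
    'CF(G) :=
  \sum_(s in 'Gal(charfield chi / 1)) galconj s.

Lemma galconj_irr (gT : finGroupType) (G : {group gT}) (chi : 'CF(G))
    (s : gal_of (charfield chi)) :
  chi \in irr G -> galconj s \in irr G.
Proof.
move=> Ichi; have [nu ->] := galconj_cfAut s (irrWchar Ichi).
by rewrite cfAut_irr.
Qed.

Lemma orbit_sum1 (gT : finGroupType) (G : {group gT}) (chi : 'CF(G)) :
    chi \is a character ->
  orbit_sum chi 1%g = (\dim (charfield chi))%:R * chi 1%g.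
Proof.
move=> Nchi; rewrite /orbit_sum sum_cfunE -card_charfield_gal.
rewrite mulr_natl -sumr_const; apply: eq_bigr => s _.
have [nu ->] := galconj_cfAut s Nchi.
by rewrite cfunE aut_natr ?Cnat_char1.
Qed.

(** The conjugates of chi are distinct irreducible characters, all with the same
    multiplicity in phi, since phi is fixed by the automorphisms that permute
    them. *)
Lemma orbit_sum_constt (gT : finGroupType) (G : {group gT})
    (phi chi : 'CF(G)) :
    phi \is a character -> (forall nu, cfAut nu phi = phi) ->
    chi \in irr G -> '[phi, chi] != 0 ->
  phi - orbit_sum chi \is a character.
Proof.
move=> Nphi autphi Ichi phi_chi; have Nchi := irrWchar Ichi.
have /fin_all_exists[i Di] (s : gal_of (charfield chi)) :
  exists i, galconj s = 'chi_i by apply/irrP/galconj_irr.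
pose A := i @: 'Gal(charfield chi / 1).
have -> : orbit_sum chi = \sum_j (j \in A)%:R *: 'chi_j.
  rewrite (bigID [in A]) /= [X in _ + X]big1 ?addr0; last first.
    by move=> j /negPf->; rewrite scale0r.
  rewrite big_imset /= => [|s t _ _ eq_i]; last first.
    by apply: (@galconj_inj _ _ chi); rewrite !Di eq_i.
  apply: eq_bigr => s Gs; rewrite -Di.
  by rewrite (imset_f i Gs) scale1r.
rewrite {1}[phi]cfun_sum_cfdot -sumrB; apply: rpred_sum => j _.
rewrite -scalerBl; have /natrP[k Dk] := Cnat_cfdot_char_irr j Nphi.
have: (j \in A) ==> ('[phi, 'chi_j] != 0).
  apply/implyP=> /imsetP[s _ ->]; rewrite -Di.
  have [nu ->] := galconj_cfAut s Nchi; rewrite -(autphi nu).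
  by rewrite cfdot_aut_char // fmorph_eq0.
rewrite Dk; case: (j \in A) => /= [|_]; last first.
  by rewrite subr0 scaler_nat rpredMn ?irr_char.
case: k {Dk} => [/eqP// | k _].
by rewrite -natr1 addrK scaler_nat rpredMn ?irr_char.
Qed.

Lemma orbit_sum_eq (gT : finGroupType) (G : {group gT}) (phi chi : 'CF(G)) :
    phi \is a character -> (forall nu, cfAut nu phi = phi) ->
    chi \in irr G -> '[phi, chi] != 0 ->
    phi 1%g = (\dim (charfield chi))%:R * chi 1%g ->
  phi = orbit_sum chi.
Proof.
move=> Nphi autphi Ichi phi_chi deg; apply/eqP; rewrite -subr_eq0 -char1_eq0.
  by rewrite !cfunE deg orbit_sum1 ?subrr ?irrWchar.
exact: orbit_sum_constt.
Qed.

Lemma cfdot_orbit_sum (gT : finGroupType) (G : {group gT}) (chi xi : 'CF(G)) :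
    chi \in irr G -> xi \in irr G -> '[orbit_sum chi, xi] != 0 ->
  exists nu : {rmorphism algC -> algC}, xi = cfAut nu chi.
Proof.
move=> Ichi Ixi; rewrite cfdot_suml.
have [[s /eqP<-] _ | no_s] :=
  pickP (fun s : gal_of (charfield chi) => galconj s == xi).
  exact/galconj_cfAut/irrWchar.
rewrite big1 ?eqxx // => s _; have:= no_s s.
have /irrP[i ->] := galconj_irr s Ichi; have /irrP[j ->] := Ixi.
by rewrite cfdot_irr (inj_eq irr_inj) => ->.
Qed.

(** The character of a nonzero submodule has a conjugate of chi as constituent,
    hence chi itself, hence the whole orbit sum: the submodule has full rank. *)
Lemma orbit_sum_irreducible (gT : finGroupType) (G : {group gT}) (chi : 'CF(G))
    (n : nat) (rG : mx_representation rat G n) :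
  chi \in irr G -> affords rG (orbit_sum chi) -> mx_irreducible rG.
Proof.
move=> Ichi rG_chi; have Nchi := irrWchar Ichi.
have deg_n: orbit_sum chi 1%g = n%:R by rewrite -rG_chi cfRepr1.
apply/mx_irrP; split.
  rewrite -(ltr_nat algC) -deg_n orbit_sum1 // mulr_gt0 ?irr_gt0 //.
    by rewrite ltr0n adim_gt0.
  by have /irrP[i ->] := Ichi; apply: irr1_gt0.
move=> U modU nzU.
pose phi1 := cfRepr (map_repr (@ratr algC) (submod_repr modU)).
pose phi2 := cfRepr (map_repr (@ratr algC) (factmod_repr modU)).
have aut1 nu: cfAut nu phi1 = phi1.
  by apply: (@affords_cfAut _ _ _ (submod_repr modU)).
have N1: phi1 \is a character by apply: cfRepr_char.
have N2: phi2 \is a character by apply: cfRepr_char.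
have sum12: orbit_sum chi = phi1 + phi2.
  rewrite -rG_chi; apply/cfun_inP=> x Gx; rewrite !cfunE Gx !mulr1n.
  by rewrite /= /map_repr_mx !trace_map_mx -rmorphD mxtrace_sub_fact_mod.
have nz1: phi1 != 0 by rewrite -char1_eq0 // cfRepr1 pnatr_eq0 mxrank_eq0.
have [i phi1_i] := neq0_has_constt nz1.
have{phi1_i} phi1_chi: '[phi1, chi] != 0.
  have: i \in irr_constt (phi1 + phi2).
    move: phi1_i; rewrite !irr_consttE cfdotDl.
    have /natrP[k ->] := Cnat_cfdot_char_irr i N1.
    have /natrP[m ->] := Cnat_cfdot_char_irr i N2.
    by rewrite -natrD !pnatr_eq0 addn_eq0 => /negPf->.
  rewrite -sum12 irr_consttE => /(cfdot_orbit_sum Ichi (mem_irr i))[nu Di].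
  move: phi1_i; rewrite irr_consttE Di -[in '[phi1, _]](aut1 nu).
  by rewrite cfdot_aut_char // fmorph_eq0.
have N3 := orbit_sum_constt N1 aut1 Ichi phi1_chi.
rewrite -col_leq_rank -(ler_nat algC) -deg_n -subr_ge0.
by have:= char1_ge0 N3; rewrite cfunE [X in _ + X]cfunE cfRepr1.
Qed.

Lemma orbit_sum_split (gT : finGroupType) (G : {group gT}) (chi : 'CF(G)) :
    chi \in irr G ->
  exists2 theta, theta \is a character & orbit_sum chi = chi + theta.
Proof.
move=> Ichi; rewrite /orbit_sum (bigD1 1%g) //= galconj1 ?irrWchar //.
eexists; last reflexivity.
by apply: rpred_sum => s _; apply/irrWchar/galconj_irr.
Qed.

(** Schur: the kernel and the image of an intertwiner are submodules. *)
Lemma mx_rsim_intertwine (F : fieldType) (gT : finGroupType) (G : {group gT})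
    (n1 n2 : nat) (rG1 : mx_representation F G n1)
    (rG2 : mx_representation F G n2) (X : 'M_(n1, n2)) :
    mx_irreducible rG1 -> mx_irreducible rG2 ->
    {in G, forall x, rG1 x *m X = X *m rG2 x} -> X != 0 ->
  mx_rsim rG1 rG2.
Proof.
move=> /mx_irrP[_ irr1] /mx_irrP[_ irr2] homX nzX.
have injX: row_free X.
  rewrite -kermx_eq0; apply: contraNT nzX => /irr1.
  rewrite -sub1mx => /(_ _)/sub_kermxP; rewrite mul1mx => -> //.
  apply/mxmoduleP=> x Gx; apply/sub_kermxP.
  by rewrite -mulmxA homX // mulmxA mulmx_ker mul0mx.
have surX: row_full X.
  suffices: row_full <<X>>%MS by rewrite -!sub1mx genmxE.
  apply: irr2.
    apply/mxmoduleP=> x Gx.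
    by rewrite (eqmxMr _ (genmxE X)) genmxE -homX ?submxMl.
  by rewrite -submx0 genmxE submx0.
by exists X => //; rewrite -(eqP injX) (eqP surX).
Qed.

(** Averaging an elementary matrix over G gives an intertwiner X i k, whose
    (i, k) entry is the sum of (rG1 x^-1) i i * (rG2 x) k k. Summing these
    entries over i and k gives the sum of products of traces, so some
    X i k is not zero. No extension of scalars is involved, which is the point:
    isomorphism is obtained over the field F itself. *)
Lemma mx_rsim_trace (F : fieldType) (gT : finGroupType) (G : {group gT})
    (n1 n2 : nat) (rG1 : mx_representation F G n1)
    (rG2 : mx_representation F G n2) :
    mx_irreducible rG1 -> mx_irreducible rG2 ->
    \sum_(x in G) \tr (rG1 x^-1%g) * \tr (rG2 x) != 0 ->
  mx_rsim rG1 rG2.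
Proof.
move=> irr1 irr2 nz_tr.
pose X i k := \sum_(x in G) rG1 x^-1%g *m delta_mx i k *m rG2 x.
have homX i k: {in G, forall y, rG1 y *m X i k = X i k *m rG2 y}.
  move=> y Gy; rewrite mulmx_sumr mulmx_suml (reindex_acts 'R _ Gy) /=.
    apply: eq_bigr => x Gx; rewrite !mulmxA -repr_mxM ?groupV ?groupM //.
    by rewrite invMg mulKVg repr_mxM // mulmxA.
  by apply/actsP=> z Gz x; rewrite /= groupMr.
have [i [k nzX]]: exists i, exists k, X i k != 0.
  have [/existsP[i /existsP[k nzX]] | /existsPn X0] :=
    boolP [exists i, [exists k, X i k != 0]]; first by exists i, k.
  case/eqP: nz_tr; transitivity (\sum_i \sum_k X i k i k).
    under eq_bigr do rewrite /mxtrace big_distrlr /=.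
    rewrite exchange_big; apply: eq_bigr => i _; rewrite /=.
    rewrite exchange_big; apply: eq_bigr => k _; rewrite /= summxE.
    apply: eq_bigr => x _; rewrite mxE (bigD1 k) //= big1 => [|j /negPf k'j].
      rewrite mxE (bigD1 i) //= big1 => [|j /negPf i'j]; rewrite !mxE.
        by rewrite !eqxx mulr1 !addr0.
      by rewrite i'j mulr0.
    by rewrite mxE big1 ?mul0r // => l _; rewrite !mxE k'j andbF mulr0.
  apply: big1 => i _; apply: big1 => k _.
  by have:= X0 i => /existsPn/(_ k); rewrite negbK => /eqP->; rewrite mxE.
exact: mx_rsim_intertwine (homX i k) nzX.
Qed.

Lemma affords_rsim (gT : finGroupType) (G : {group gT}) (n1 n2 : nat)
    (rG1 : mx_representation rat G n1) (rG2 : mx_representation rat G n2)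
    (phi1 phi2 : 'CF(G)) :
    mx_irreducible rG1 -> mx_irreducible rG2 ->
    affords rG1 phi1 -> affords rG2 phi2 -> '[phi1, phi2] != 0 ->
  mx_rsim rG1 rG2.
Proof.
move=> irr1 irr2 aff1 aff2 phi12; apply: mx_rsim_trace => //.
rewrite cfdotC fmorph_eq0 cfdotE mulf_eq0 negb_or in phi12.
have [_ phi21] := andP phi12; apply: contraNneq phi21 => sum0.
rewrite -[X in _ == X](rmorph0 (@ratr algC)) -sum0 rmorph_sum; apply/eqP.
apply: eq_bigr => x Gx.
rewrite -aff1 -char_inv ?cfRepr_char // -aff2 !cfunE groupV Gx !mulr1n.
by rewrite rmorphM mulrC /= /map_repr_mx !trace_map_mx.
Qed.

(** A common eigenvector spans a submodule of rank 1 with character chi. *)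
Lemma eigenvector_constt (gT : finGroupType) (G : {group gT}) (n : nat)
    (rG : mx_representation algC G n) (v : 'rV_n) (chi : 'CF(G)) :
    chi \in irr G -> v != 0 -> {in G, forall x, v *m rG x = chi x *: v} ->
  '[cfRepr rG, chi] != 0.
Proof.
move=> Ichi nzv vG; pose U := <<v>>%MS.
have modU: mxmodule rG U.
  apply/mxmoduleP=> x Gx; rewrite (eqmxMr _ (genmxE v)) genmxE vG //.
  exact: scalemx_sub.
have subE: cfRepr (submod_repr modU) = chi.
  apply/cfun_inP=> x Gx; rewrite cfunE Gx mulr1n /= /submod_mx.
  have -> : val_submod 1%:M *m rG x =
      chi x *: (val_submod 1%:M : 'M_(\rank U, n)).
    have:= val_submodP (1%:M : 'M_(\rank U)); rewrite genmxE.
    by case/submxP=> D ->; rewrite -mulmxA vG // scalemxAr.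
  by rewrite linearZ /= val_submodK mxtraceZ mxtrace1 genmxE rank_rV nzv mulr1.
have -> : cfRepr rG = chi + cfRepr (factmod_repr modU).
  rewrite -subE; apply/cfun_inP=> x Gx; rewrite !cfunE Gx !mulr1n.
  by rewrite mxtrace_sub_fact_mod.
have /irrP[i ->] := Ichi; rewrite cfdotDl cfdot_irr eqxx.
have /natrP[k ->] := Cnat_cfdot_char_irr i (cfRepr_char (factmod_repr modU)).
by rewrite -natrD pnatr_eq0.
Qed.

(** * Linear characters over their field of values, and induction *)

Section LinearCharfield.

Variables (gT : finGroupType) (H : {group gT}) (psi : 'CF(H)).
Hypothesis Lpsi : psi \is a linear_char.

Lemma cfval_lin1 : cfval_in psi 1%g = 1.
Proof.
apply: (fmorph_inj (ambient_embed H)).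
by rewrite ambient_embed_cfval ?lin_charW // lin_char1 // rmorph1.
Qed.

Lemma cfval_linM :
  {in H &, {morph cfval_in psi : x y / (x * y)%g >-> x * y}}.
Proof.
move=> x y Hx Hy; apply: (fmorph_inj (ambient_embed H)).
by rewrite rmorphM /= !ambient_embed_cfval ?lin_charW // lin_charM.
Qed.

Definition charfield_lin_mx (x : gT) : 'M[subvs_of (charfield psi)]_1 :=
  (vsproj (charfield psi) (cfval_in psi x))%:M.

Lemma charfield_lin_mx_repr : mx_repr H charfield_lin_mx.
Proof.
split=> [|x y Hx Hy]; rewrite /charfield_lin_mx.
  rewrite cfval_lin1; congr _%:M; apply: subvs_inj.
  by rewrite rmorph1 vsprojK ?rpred1.
rewrite -scalar_mxM; congr _%:M; apply: subvs_inj.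
by rewrite rmorphM /= cfval_linM // !vsprojK ?rpredM ?cfval_charfield.
Qed.

Definition charfield_lin_repr := MxRepresentation charfield_lin_mx_repr.

Definition charfield_embed : {rmorphism subvs_of (charfield psi) -> algC} :=
  ambient_embed H \o vsval.

Lemma charfield_lin_reprE :
  cfRepr (map_repr charfield_embed charfield_lin_repr) = psi.
Proof.
apply/cfun_inP=> x Hx; rewrite cfunE Hx mulr1n /= /map_repr_mx trace_map_mx.
rewrite mxtrace_scalar /= vsprojK ?cfval_charfield //.
by rewrite ambient_embed_cfval ?lin_charW.
Qed.

Let b := vbasis (charfield psi).

(** Matrix of the multiplication by psi(x) on the rational vector space Q(psi),
    acting on columns of coordinates, so that the row of embedded basis
    elements is an eigenvector for psi. *)
Definition charfield_mul_mx (x : gT) : 'M[rat]_(\dim (charfield psi)) :=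
  \matrix_(i, j) coord b i (cfval_in psi x * b`_j).

Lemma charfield_basis_mem (i : 'I_(\dim (charfield psi))) :
  b`_i \in charfield psi.
Proof. by rewrite vbasis_mem // mem_nth ?size_tuple. Qed.

Lemma charfield_mul_mx_repr : mx_repr H charfield_mul_mx.
Proof.
split=> [|x y Hx Hy]; apply/matrixP=> i k; rewrite !mxE.
  by rewrite cfval_lin1 mul1r coord_free ?(basis_free (vbasisP _)) // eq_sym.
rewrite cfval_linM // -mulrA.
have Eyk: cfval_in psi y * b`_k \in charfield psi.
  by rewrite rpredM ?cfval_charfield ?charfield_basis_mem.
rewrite {1}(coord_vbasis Eyk) mulr_sumr linear_sum /=.
by apply: eq_bigr => j _; rewrite !mxE -scalerAr linearZ /= mulrC.
Qed.

Definition charfield_mul_repr := MxRepresentation charfield_mul_mx_repr.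

(** The representation contains psi, hence the orbit sum of psi, and both have
    degree |Q(psi) : Q|. *)
Lemma charfield_mul_repr_affords : affords charfield_mul_repr (orbit_sum psi).
Proof.
rewrite /affords; set phi := cfRepr _.
pose v : 'rV[algC]_(\dim (charfield psi)) :=
  \row_i ambient_embed H b`_i.
have dimK_gt0: (0 < \dim (charfield psi))%N by rewrite adim_gt0.
apply: orbit_sum_eq; first exact: cfRepr_char.
- by move=> nu; apply: (@affords_cfAut _ _ _ charfield_mul_repr).
- exact: lin_char_irr.
- apply: (@eigenvector_constt _ _ _ _ v); first exact: lin_char_irr.
    apply: contraTneq (basis_free (vbasisP (charfield psi))) => v0.
    apply/negP=> /free_not0 nz_b.
    have [i _]: exists i : 'I_(\dim (charfield psi)), true.
      by exists (Ordinal dimK_gt0).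
    have:= nz_b b`_i; rewrite mem_nth ?size_tuple // => /(_ isT)/eqP[].
    apply: (fmorph_inj (ambient_embed H)); rewrite rmorph0.
    by have /rowP/(_ i) := v0; rewrite !mxE.
  move=> x Hx; apply/rowP=> k; rewrite !mxE.
  rewrite -ambient_embed_cfval ?lin_charW // -rmorphM.
  have Exk: cfval_in psi x * b`_k \in charfield psi.
    by rewrite rpredM ?cfval_charfield ?charfield_basis_mem.
  rewrite [in RHS](coord_vbasis Exk) rmorph_sum; apply: eq_bigr => i _.
  by rewrite !mxE rmorphZ_num mulrC.
by rewrite cfRepr1 lin_char1 // mulr1.
Qed.

End LinearCharfield.

(** The degree 0 is impossible because number fields have positive dimension. *)
Lemma schur_index_eq1 (gT : finGroupType) (G : {group gT}) (chi : 'CF(G)) :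
  realized_in_degree chi 1 -> schur_index chi = 1%N.
Proof.
move=> real1; rewrite /schur_index.
set P := fun d => _; have exP: exists d, P d.
  exists 1%N; split=> // -[|//] [K [f [n [rG [_ /eqP]]]]].
  by rewrite mul0n gtn_eqF ?adim_gt0.
have [real_d min_d] := epsilon_spec (inhabits 0%N) P exP.
apply/eqP; rewrite eqn_leq min_d //=.
case: (epsilon _ P) real_d => // -[K [f [n [rG [_ /eqP]]]]].
by rewrite mul0n gtn_eqF ?adim_gt0.
Qed.

(** The trace only sees the diagonal blocks, and the sum over G in the formula
    for an induced character is constant on each right coset of H. *)
Lemma cfRepr_induced (F : fieldType) (f : {rmorphism F -> algC})
    (gT : finGroupType) (G H : {group gT}) (sHG : H \subset G) (n : nat)
    (rH : mx_representation F H n) :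
  cfRepr (map_repr f (induced_repr sHG rH)) = 'Ind[G] (cfRepr (map_repr f rH)).
Proof.
apply/cfun_inP=> x Gx; rewrite cfIndE // cfunE Gx mulr1n.
rewrite /= /map_repr_mx trace_map_mx mxtrace_mxblock rmorph_sum /=.
set phi := cfRepr _.
have blockE i : f (\tr (induced_block rH x i i)) = phi (x ^ (coset_rep i)^-1)%g.
  rewrite cfunE /induced_block conjgE invgK mulgA.
  case: ifP => _; last by rewrite mxtrace0 rmorph0.
  by rewrite mulr1n -trace_map_mx.
under eq_bigr do rewrite blockE.
rewrite (reindex_inj invg_inj) (eq_bigl [in G]) => [|y]; last exact: groupV.
rewrite (set_partition_big _ (rcosets_partition sHG)) /=.
rewrite (eq_bigr (fun A => #|H|%:R * phi (x ^ (repr A)^-1)%g)); last first.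
  move=> _ /rcosetsP[y Gy ->].
  have [h Hh] := repr_rcosetP H y; rewrite mulr_natl.
  rewrite -(card_rcoset H y) -sumr_const.
  apply: eq_bigr => _ /rcosetP[k Hk ->]; rewrite !invMg !conjgM.
  by rewrite cfunJ ?groupV // [RHS]cfunJ ?groupV.
by rewrite -mulr_sumr mulKf ?neq0CG // [RHS]big_enum_val.
Qed.

(** * Characters of a p-group whose centre has index p^2 *)

Lemma irrZ_lin (gT : finGroupType) (G : {group gT}) (mu : 'CF('Z(G))) :
  irrZ_over_der mu -> mu \is a linear_char.
Proof. by case=> /irrP[j ->] _; apply/char_abelianP/center_abelian. Qed.

Lemma mem_cfker_char (gT : finGroupType) (G : {group gT}) (chi : 'CF(G)) x :
  chi \is a character -> x \in G -> (x \in cfker chi) = (chi x == chi 1%g).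
Proof. by move=> Nchi Gx; rewrite cfkerEchar // inE Gx. Qed.

Lemma chi_of_center (p : nat) (gT : finGroupType) (G : {group gT})
    (mu : 'CF('Z(G))) z :
  z \in 'Z(G) -> chi_of p mu z = p%:R * mu z.
Proof. by move=> Zz; have [Gz _] := setIP Zz; rewrite cfunE Zz. Qed.

Lemma chi_of_off_center (p : nat) (gT : finGroupType) (G : {group gT})
    (mu : 'CF('Z(G))) x :
  x \notin 'Z(G) -> chi_of p mu x = 0.
Proof. by move=> /negPf Z'x; rewrite cfunE Z'x. Qed.

(** Schur's lemma on the centre, read off from the restriction to 'Z('chi_i),
    which contains it. *)
Lemma central_char (gT : finGroupType) (G : {group gT}) (i : Iirr G) :
  exists2 mu : 'CF('Z(G)), mu \is a linear_char
    & {in 'Z(G), forall z, 'chi_i z = 'chi_i 1%g * mu z}.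
Proof.
have [xi Lxi Dxi] := cfcenter_Res 'chi_i.
have sZZ: 'Z(G) \subset 'Z('chi_i)%CF by rewrite -cap_cfcenter_irr bigcap_inf.
exists ('Res['Z(G)] xi) => [|z Zz]; first exact: cfRes_lin_char.
have /cfunP/(_ z) := Dxi.
by rewrite cfunE cfResE ?cfcenter_sub ?(subsetP sZZ) // => ->; rewrite cfResE.
Qed.

Section CenterIndexP2.

Variables (p : nat) (gT : finGroupType) (G : {group gT}).
Hypotheses (p_pr : prime p) (pG : p.-group G).
Hypothesis indexZ : #|G : 'Z(G)| = (p ^ 2)%N.

Let p_gt0 : (0 < p)%N := prime_gt0 p_pr.
Let sZG : 'Z(G) \subset G := center_sub G.

Lemma der1_sub_center : G^`(1)%g \subset 'Z(G).
Proof.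
have nZG: 'Z(G) <| G := center_normal G.
rewrite der1_min ?normal_norm // (p2group_abelian (quotient_pgroup _ pG)) //.
by rewrite card_quotient ?normal_norm // indexZ pfactorK.
Qed.

(** The bound 'chi_i(1)^2 <= |G : 'Z('chi_i)| <= p^2 on a power of p greater
    than 1 is attained, and it is attained only by characters that vanish
    outside 'Z('chi_i), which then equals the centre. *)
Lemma nonlinear_irr_center (i : Iirr G) :
    ~~ (G^`(1)%g \subset cfker 'chi_i) ->
  'chi_i 1%g = p%:R /\ {in G, forall x, x \notin 'Z(G) -> 'chi_i x = 0}.
Proof.
move=> nker; have [bound eq_bound] := irr1_bound i.
have sZZ: 'Z(G) \subset 'Z('chi_i)%CF by rewrite -cap_cfcenter_irr bigcap_inf.
have sZcG := cfcenter_sub 'chi_i.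
have index_le: (#|G : 'Z('chi_i)%CF| <= p ^ 2)%N.
  by rewrite -indexZ dvdn_leq ?indexgS.
have := dvd_irr1_cardG i; have /natrP[n Dn] := Cnat_irr1 i.
rewrite Dn in bound eq_bound *; rewrite dvdC_nat => n_dv_G.
have{n_dv_G} [k Dk] := p_natP (pnat_dvd n_dv_G pG).
have k_gt0: (0 < k)%N.
  rewrite lt0n; apply: contra nker => /eqP k0.
  by rewrite lin_char_der1 // qualifE /= irr_char Dn Dk k0 expn0 /= eqxx.
have Dn2: (n ^ 2 = #|G : 'Z('chi_i)%CF| /\ #|G : 'Z('chi_i)%CF| = p ^ 2)%N.
  have le1: (n ^ 2 <= #|G : 'Z('chi_i)%CF|)%N by rewrite -(ler_nat algC) natrX.
  have le2: (p ^ 2 <= n ^ 2)%N.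
    by rewrite Dk leq_exp2r // -{1}(expn1 p) leq_pexp2l.
  by split; apply/eqP; rewrite eqn_leq ?le1 ?index_le ?(leq_trans le2) //
    (leq_trans index_le).
have [Dn2l Dn2r] := Dn2; split.
  by congr _%:R; apply/eqP; rewrite -(@eqn_exp2r _ _ 2) // Dn2l Dn2r.
have eqZ: 'Z('chi_i)%CF = 'Z(G) :> {set gT}.
  apply/esym/eqP; rewrite eqEcard sZZ /=.
  have := Lagrange sZG; rewrite indexZ -(Lagrange sZcG) Dn2r => /eqP.
  by rewrite eqn_pmul2r ?expn_gt0 ?p_gt0 // => /eqP->.
have: 'chi_i \in 'CF(G, 'Z('chi_i)%CF).
  by rewrite -eq_bound -natrX Dn2l.
by move=> CFi x _ Z'x; rewrite (cfun_on0 CFi) // eqZ.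
Qed.

Lemma nonlinear_irr_chi_of (i : Iirr G) :
    ~~ (G^`(1)%g \subset cfker 'chi_i) ->
  exists2 mu, irrZ_over_der mu & 'chi_i = chi_of p mu.
Proof.
move=> nker; have [chi1 chi0] := nonlinear_irr_center nker.
have [mu Lmu Dmu] := central_char i; exists mu.
  split; first exact: lin_char_irr.
  apply: contra nker => /subsetP kermu; apply/subsetP=> x G'x.
  have Zx := subsetP der1_sub_center x G'x.
  have := kermu x G'x; rewrite !mem_cfker_char ?irr_char ?lin_charW //.
    by rewrite lin_char1 // Dmu // => /eqP->; rewrite mulr1.
  exact: subsetP sZG x Zx.
apply/cfun_inP=> x Gx; have [Zx | Z'x] := boolP (x \in 'Z(G)).
  by rewrite chi_of_center // Dmu // chi1.
by rewrite chi_of_off_center // chi0.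
Qed.

(** An irreducible constituent of the character induced from mu has central
    character mu, and is then determined by [nonlinear_irr_center]. *)
Lemma chi_of_irr (mu : 'CF('Z(G))) :
  irrZ_over_der mu -> chi_of p mu \in irr G.
Proof.
move=> irrmu; have Lmu := irrZ_lin irrmu; case: irrmu => Imu nker.
have nzInd: 'Ind[G] mu != 0.
  rewrite cfInd_eq0 ?irrWchar //; have /irrP[j ->] := Imu.
  exact: irr_neq0.
have [i ind_i] := neq0_has_constt nzInd.
have [nu Lnu Dnu] := central_char i.
have Res_i: 'Res['Z(G)] 'chi_i = 'chi_i 1%g *: nu.
  by apply/cfun_inP=> z Zz; rewrite cfResE // cfunE Dnu.
have Dmu: nu = mu.
  move: ind_i; rewrite irr_consttE -cfdot_Res_r Res_i cfdotZr.
  have /irrP[j ->] := lin_char_irr Lnu; have /irrP[k ->] := Imu.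
  rewrite cfdot_irr; have [-> // | _] := eqVneq k j.
  by rewrite mulr0 eqxx.
rewrite {nu}Dmu in Lnu Dnu Res_i.
have nker_i: ~~ (G^`(1)%g \subset cfker 'chi_i).
  apply: contra nker => /subsetP keri; apply/subsetP=> x G'x.
  have Zx := subsetP der1_sub_center x G'x.
  have Gx := subsetP sZG x Zx.
  have := keri x G'x; rewrite !mem_cfker_char ?irr_char ?lin_charW //.
  rewrite (lin_char1 Lnu) Dnu //.
  rewrite -subr_eq0 -{2}['chi_i 1%g]mulr1 -mulrBr mulf_eq0.
  by rewrite (negPf (irr1_neq0 i)) subr_eq0.
have [chi1 chi0] := nonlinear_irr_center nker_i.
suffices ->: chi_of p mu = 'chi_i by apply: mem_irr.
apply/cfun_inP=> x Gx; have [Zx | Z'x] := boolP (x \in 'Z(G)).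
  by rewrite chi_of_center // Dnu // chi1.
by rewrite chi_of_off_center // chi0.
Qed.

(** By reciprocity chi_mu is a constituent of the induced character: only Z
    contributes to the scalar product with psi. Both have degree p. *)
Lemma Ind_chi_of (H : {group gT}) (mu : 'CF('Z(G))) (psi : 'CF(H)) :
    irrZ_over_der mu -> H \subset G -> 'Z(G) \subset H -> #|G : H| = p ->
    psi \is a linear_char -> {in 'Z(G), psi =1 mu} ->
  'Ind[G] psi = chi_of p mu.
Proof.
move=> Imu sHG sZH iHG Lpsi psi_mu.
have Lmu := irrZ_lin Imu.
have /irrP[i Di] := chi_of_irr Imu.
have Nind: 'Ind[G] psi \is a character by rewrite cfInd_char ?lin_charW.
have: i \in irr_constt ('Ind[G] psi).
  rewrite irr_consttE -Di -cfdot_Res_r cfdotE mulf_neq0 ?invr_eq0 ?neq0CG //.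
  rewrite (big_setID 'Z(G)) /= (setIidPr sZH) [X in _ + X]big1 ?addr0.
    rewrite (eq_bigr (fun=> p%:R)) => [|z Zz].
      by rewrite sumr_const -mulrnA pnatr_eq0 -lt0n muln_gt0 cardG_gt0 p_gt0.
    rewrite cfResE ?(subsetP sZH) // chi_of_center // psi_mu //.
    by rewrite rmorphM rmorph_nat mulrCA -normCK normC_lin_char // expr1n mulr1.
  move=> x /setDP[Hx Z'x].
  by rewrite cfResE // chi_of_off_center // rmorph0 mulr0.
case/(constt_charP _ Nind) => theta Ntheta Dind.
suffices theta0: theta = 0 by rewrite Dind Di theta0 addr0.
apply/eqP; rewrite -char1_eq0 //.
have /cfunP/(_ 1%g) := Dind; rewrite cfInd1 // iHG (lin_char1 Lpsi) mulr1.
rewrite cfunE -Di chi_of_center ?group1 // (lin_char1 Lmu) mulr1.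
by move/eqP; rewrite -subr_eq0 opprD addNKr oppr_eq0.
Qed.

End CenterIndexP2.

(** * Extending a central character *)

(** The character induced from the trivial character of C is supported on C, and
    mu is 1 on the part of C that lies in Z, so the restriction of this
    character to Z is not orthogonal to mu. A constituent that lies over mu is
    linear and, by reciprocity, trivial on C. *)
Lemma extend_lin_char (gT : finGroupType) (H Z C : {group gT}) (mu : 'CF(Z)) :
    abelian H -> Z \subset H -> C \subset H -> mu \is a linear_char ->
    Z :&: C \subset cfker mu ->
  exists psi : 'CF(H), [/\ psi \is a linear_char, {in Z, psi =1 mu}
    & {in C, forall x, psi x = 1}].
Proof.
move=> abH sZH sCH Lmu kermu.
pose theta := 'Ind[H, C] 1; have Ntheta: theta \is a character.
  by rewrite cfInd_char ?cfun1_char.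
have thetaE z: z \in H -> theta z = (#|H : C| * (z \in C))%:R.
  move=> Hz; rewrite cfIndE // (eq_bigr (fun=> (z \in C)%:R)) => [|y Hy].
    rewrite sumr_const -mulrnA mulnC !natrM mulrA natf_indexg //.
    by rewrite [_^-1 * _]mulrC.
  by rewrite (conjg_fixP _) ?cfun1E //; apply/commgP/(centsP abH).
have nz_mu: '['Res[Z] theta, mu] != 0.
  rewrite cfdotE mulf_neq0 ?invr_eq0 ?neq0CG //.
  rewrite (eq_bigr (fun z => (#|H : C| * (z \in C))%:R)) => [|z Zz].
    rewrite -natr_sum pnatr_eq0 -lt0n (bigD1 1%g) //= group1 muln1.
    by rewrite ltn_addr ?indexg_gt0.
  rewrite cfResE // thetaE ?(subsetP sZH) //.
  have [Cz | _] := boolP (z \in C); last by rewrite muln0 mul0r.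
  rewrite cfker1 ?lin_char1 ?rmorph1 ?mulr1 //.
  by rewrite (subsetP kermu) // inE Zz.
have /existsP[i /andP[theta_i mu_i]]: [exists i : Iirr H,
    ('[theta, 'chi_i] != 0) && ('['Res[Z] 'chi_i, mu] != 0)].
  apply: contraNT nz_mu => /existsPn no_i.
  rewrite [theta]cfun_sum_cfdot linear_sum cfdot_suml big1 // => i _.
  rewrite linearZ cfdotZl; have:= no_i i; rewrite negb_and !negbK.
  by case/orP=> /eqP->; rewrite ?mul0r ?mulr0.
have Li: 'chi_i \is a linear_char by apply/char_abelianP.
have lin_eq (K : {group gT}) (xi zeta : 'CF(K)) : xi \is a linear_char ->
    zeta \is a linear_char -> '[xi, zeta] != 0 -> xi = zeta.
  move=> /lin_char_irr/irrP[j ->] /lin_char_irr/irrP[k ->].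
  by rewrite cfdot_irr; have [->|] := eqVneq j k; rewrite ?eqxx.
have ResZ: 'Res[Z] 'chi_i = mu by apply: lin_eq; rewrite ?cfRes_lin_char.
have ResC: 1 = 'Res[C] 'chi_i.
  by apply: lin_eq; rewrite ?cfun1_lin_char ?cfRes_lin_char // cfdot_Res_r.
exists 'chi_i; split=> // [z Zz | x Cx]; first by rewrite -ResZ cfResE.
by rewrite -(cfResE _ sCH) // -ResC cfun1E Cx.
Qed.

(** * The pairs and their induced representations *)

(** A power h^k in Z has p dividing k: otherwise h would be a product of powers
    of h^k and h^p. *)
Lemma cap_cycle_cfker (p : nat) (gT : finGroupType) (Z : {group gT})
    (mu : 'CF(Z)) (h : gT) :
    prime p -> mu \is a linear_char -> h \notin Z -> (h ^+ p)%g \in Z ->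
    mu (h ^+ p)%g = 1 ->
  Z :&: <[h]> \subset cfker mu.
Proof.
move=> p_pr Lmu Z'h Zhp mu1; apply/subsetP=> x /setIP[Zx /cycleP[k Dx]].
rewrite Dx in Zx *; rewrite mem_cfker_char ?lin_charW // lin_char1 //.
have [/dvdnP[m ->] | p'k] := boolP (p %| k)%N.
  by rewrite mulnC expgM lin_charX // mu1 expr1n.
have k_gt0: (0 < k)%N by rewrite lt0n; apply: contraNneq p'k => ->.
case/negP: Z'h; have:= prime_coprime k p_pr; rewrite p'k => co_pk.
case: (egcdnP p k_gt0) => u v Duv _.
rewrite gcdnC (eqP co_pk) in Duv.
have: (h ^+ (u * k))%g \in Z by rewrite mulnC expgM groupX.
by rewrite Duv expgD expg1 mulnC expgM groupMl // groupX.
Qed.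

Section InducedPair.

Variables (p : nat) (gT : finGroupType) (G : {group gT}).
Hypotheses (p_pr : prime p) (pG : p.-group G).
Hypothesis indexZ : #|G : 'Z(G)| = (p ^ 2)%N.

Variables (mu : 'CF('Z(G))) (H : {group gT}) (psi : 'CF(H)) (h : gT).
Hypotheses (Imu : irrZ_over_der mu) (Gh : h \in G) (Z'h : h \notin 'Z(G)).
Hypotheses (DH : H = 'Z(G) <*> <[h]> :> {set gT}).
Hypotheses (Lpsi : psi \is a linear_char) (psi_mu : {in 'Z(G), psi =1 mu}).
Hypothesis psi_h : psi h = 1.

Let p_gt0 : (0 < p)%N := prime_gt0 p_pr.
Let sZG : 'Z(G) \subset G := center_sub G.

Lemma center_sub_pair : 'Z(G) \subset H.
Proof. by rewrite DH joing_subl. Qed.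

Lemma pair_sub : H \subset G.
Proof. by rewrite DH join_subG sZG cycle_subG. Qed.

Lemma center_cycle_mul : 'Z(G) <*> <[h]> = ('Z(G) * <[h]>)%g.
Proof.
rewrite cent_joinEr // cycle_subG.
by apply: subsetP Gh; rewrite centsC subsetIr.
Qed.

Lemma pair_abelian : abelian H.
Proof.
rewrite DH center_cycle_mul abelianM center_abelian cycle_abelian /=.
by rewrite cycle_subG; apply: subsetP Gh; rewrite centsC subsetIr.
Qed.

(** H lies strictly between 'Z(G) and G: it contains h, and it is abelian. *)
Lemma pair_index : #|G : H| = p.
Proof.
have := Lagrange_index pair_sub center_sub_pair; rewrite indexZ => Dp2.
have /(dvdn_pfactor _ _ p_pr)[m le_m2 Dm]: (#|G : H| %| p ^ 2)%N.
  by rewrite -Dp2 dvdn_mulr.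
rewrite Dm; case: m le_m2 Dm => [|[|[|//]]] _ Dm; rewrite ?expn1 //.
  case/negP: Z'h; rewrite inE Gh /=.
  have /eqP: #|G : H| = 1%N by rewrite Dm.
  rewrite indexg_eq1 => sGH; apply: subsetP Gh.
  have := pair_abelian; rewrite /abelian => /(subset_trans sGH).
  by rewrite centsC => /(subset_trans sGH).
case/negP: Z'h; move/eqP: Dp2.
rewrite Dm -{2}[(p ^ 2)%N]muln1 eqn_pmul2l ?expn_gt0 ?p_gt0 //.
rewrite indexg_eq1 => /subsetP-> //.
by rewrite DH (subsetP (joing_subr _ _)) ?cycle_id.
Qed.

Lemma pair_values x : x \in H -> exists2 z, z \in 'Z(G) & psi x = mu z.
Proof.
move=> Hx; have: x \in ('Z(G) * <[h]>)%g by rewrite -center_cycle_mul -DH.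
case/mulsgP=> z _ Zz /cycleP[k ->] ->.
have Hh: h \in H by rewrite DH (subsetP (joing_subr _ _)) ?cycle_id.
have Hz := subsetP center_sub_pair z Zz.
exists z => //; rewrite lin_charM ?groupX //.
by rewrite lin_charX // psi_h expr1n mulr1 psi_mu.
Qed.

Let chi := chi_of p mu.

Lemma Ind_pair : 'Ind[G] psi = chi.
Proof.
by apply: Ind_chi_of => //;
  [exact: pair_sub | exact: center_sub_pair | exact: pair_index].
Qed.

Let Ichi : chi \in irr G := chi_of_irr p_pr pG indexZ Imu.

Lemma chi_of_deg : chi 1%g = p%:R.
Proof.
by rewrite -Ind_pair cfInd1 ?pair_sub // pair_index lin_char1 ?mulr1.
Qed.

Lemma same_charfield_pair : same_charfield psi chi.
Proof.
have Nchi := irrWchar Ichi; have Npsi := lin_charW Lpsi.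
move=> z; split; apply: in_charfield_min => // {z} x; [move=> Hx | move=> Gx].
  have [z Zz ->] := pair_values Hx.
  have -> : mu z = ratr p%:R^-1 * chi z.
    by rewrite chi_of_center // fmorphV rmorph_nat mulKf // pnatr_eq0 -lt0n.
  apply: in_charfieldM; first exact: in_charfield_rat.
  exact: in_charfield_cfun.
have [Zx | Z'x] := boolP (x \in 'Z(G)); last first.
  rewrite [chi x]chi_of_off_center // -(rmorph0 (@ratr algC)).
  exact: in_charfield_rat.
rewrite [chi x]chi_of_center // -psi_mu // -(rmorph_nat (@ratr algC)).
apply: in_charfieldM; first exact: in_charfield_rat.
exact: in_charfield_cfun.
Qed.

Lemma schur_index_lin : schur_index psi = 1%N.
Proof.
apply: schur_index_eq1.
exists (subvs_of (charfield psi)), (charfield_embed psi).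
exists 1%N, (charfield_lin_repr Lpsi); split; first exact: charfield_lin_reprE.
by rewrite mul1n dimvf.
Qed.

(** Inducing the realization of psi over Q(psi), which is also Q(chi_mu). *)
Lemma schur_index_chi_of : schur_index chi = 1%N.
Proof.
apply: schur_index_eq1.
exists (subvs_of (charfield psi)), (charfield_embed psi).
exists _, (induced_repr pair_sub (charfield_lin_repr Lpsi)); split.
  by rewrite cfRepr_induced charfield_lin_reprE Ind_pair.
by rewrite mul1n dimvf; apply: same_charfield_dim same_charfield_pair.
Qed.

Lemma Omega_lin : Omega psi = orbit_sum psi.
Proof. by rewrite /Omega schur_index_lin scale1r. Qed.

Lemma Omega_chi_of : Omega chi = orbit_sum chi.
Proof. by rewrite /Omega schur_index_chi_of scale1r. Qed.

(** The induced character contains chi_mu, hence its orbit sum, and the degrees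
    agree because Q(psi) and Q(chi_mu) have the same dimension. *)
Lemma induced_affords (sHG : H \subset G) (m : nat)
    (Psi : mx_representation rat H m) :
  affords Psi (Omega psi) -> affords (induced_repr sHG Psi) (Omega chi).
Proof.
rewrite Omega_lin Omega_chi_of => aff_psi; have Ipsi := lin_char_irr Lpsi.
rewrite /affords; set phi := cfRepr _.
have Dphi: phi = 'Ind[G] (orbit_sum psi) by rewrite /phi cfRepr_induced aff_psi.
apply: orbit_sum_eq => //; first exact: cfRepr_char.
- by move=> nu; apply: (@affords_cfAut _ _ _ (induced_repr sHG Psi)).
- have [theta Ntheta Dpsi] := orbit_sum_split Ipsi.
  rewrite Dphi Dpsi linearD /= Ind_pair cfdotDl; have /irrP[i ->] := Ichi.
  rewrite cfdot_irr eqxx.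
  have /natrP[k ->] := Cnat_cfdot_char_irr i (cfInd_char G Ntheta).
  by rewrite -natrD pnatr_eq0.
rewrite Dphi cfInd1 // orbit_sum1 ?lin_charW // lin_char1 // mulr1 pair_index.
by rewrite chi_of_deg mulrC (same_charfield_dim same_charfield_pair).
Qed.

Lemma induced_irreducible (sHG : H \subset G) (m : nat)
    (Psi : mx_representation rat H m) :
  affords Psi (Omega psi) -> mx_irreducible (induced_repr sHG Psi).
Proof.
move/(induced_affords sHG); rewrite Omega_chi_of.
exact: orbit_sum_irreducible.
Qed.

(** An element of G' in this kernel would be in the kernel of the constituent
    chi_mu, hence in that of mu. *)
Lemma induced_rker (sHG : H \subset G) (m : nat)
    (Psi : mx_representation rat H m) :
  affords Psi (Omega psi) -> ~~ (G^`(1)%g \subset rker (induced_repr sHG Psi)).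
Proof.
move/(induced_affords sHG) => aff.
have [_ nker] := Imu; apply: contra nker.
rewrite -(rker_map (@ratr algC)) -cfker_repr aff Omega_chi_of.
have [theta Ntheta ->] := orbit_sum_split Ichi.
have Nchi := irrWchar Ichi => kerD.
have sG'Z := der1_sub_center p_pr pG indexZ.
apply/subsetP=> x G'x; have Zx := subsetP sG'Z x G'x.
have Lmu := irrZ_lin Imu.
have: x \in cfker chi.
  have /irrP[i Di] := Ichi.
  have: chi + theta \is a character by rewrite rpredD.
  move=> Nsum; move/subsetP/(_ x G'x): kerD; rewrite (cfkerE Nsum) inE.
  case/andP=> _ /bigcapP/(_ i); rewrite Di; apply.
  by apply/constt_charP; rewrite -?Di //; exists theta; rewrite -?Di.
have Gx := subsetP sZG x Zx.
rewrite (mem_cfker_char Nchi Gx) (mem_cfker_char (lin_charW Lmu) Zx).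
rewrite chi_of_deg (lin_char1 Lmu).
rewrite [chi x]chi_of_center //.
rewrite -subr_eq0 -{2}[p%:R]mulr1 -mulrBr mulf_eq0 pnatr_eq0 eqn0Ngt p_gt0.
by rewrite subr_eq0.
Qed.

End InducedPair.

(** All six families reduce to this criterion: the pair listed for mu must be
    the extension of mu to 'Z(G)<h> that is trivial at h, for a noncentral h
    with h^p in the kernel of mu. *)
Lemma pairs_determine_irreps_of (p : nat) (gT : finGroupType) (G : {group gT})
    (listed : 'CF('Z(G)) -> forall H : {group gT}, 'CF(H) -> Prop) :
    prime p -> p.-group G -> #|G : 'Z(G)| = (p ^ 2)%N ->
    (forall mu, irrZ_over_der mu -> exists h,
       [/\ h \in G, h \notin 'Z(G), (h ^+ p)%g \in 'Z(G), mu (h ^+ p)%g = 1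
         & forall (H : {group gT}) (psi : 'CF(H)), listed mu H psi <->
             [/\ H = 'Z(G) <*> <[h]> :> {set gT}, psi \is a linear_char,
                 {in 'Z(G), psi =1 mu} & psi h = 1]]) ->
  pairs_determine_irreps p listed.
Proof.
move=> p_pr pG indexZ listedP; split=> [mu Imu | mu H psi Imu | mu H psi Imu
  | mu H psi sHG m Psi Imu | n rG irrG nker].
- have [h [Gh Z'h Zhp mu_hp lstP]] := listedP mu Imu.
  have Lmu := irrZ_lin Imu.
  pose H := ('Z(G) <*> <[h]>)%G.
  have abH: abelian H by apply: (@pair_abelian _ G H h).
  have [psi [Lpsi psi_mu psi1]] := extend_lin_char abH (joing_subl _ _)
    (joing_subr _ _) Lmu (cap_cycle_cfker p_pr Lmu Z'h Zhp mu_hp).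
  by exists H, psi; apply/lstP; split=> //; rewrite psi1 ?cycle_id.
- have [h [Gh Z'h _ _ lstP]] := listedP mu Imu.
  case/lstP=> DH Lpsi psi_mu psi_h.
  have sHG := pair_sub Gh DH.
  have aff : affords (charfield_mul_repr Lpsi) (Omega psi).
    by rewrite Omega_lin //; apply: charfield_mul_repr_affords.
  exists _, (induced_repr sHG (charfield_mul_repr Lpsi)).
  have aff_chi := induced_affords p_pr pG indexZ Imu Gh Z'h DH Lpsi psi_mu
    psi_h sHG aff.
  have irr_ind := induced_irreducible p_pr pG indexZ Imu Gh Z'h DH Lpsi psi_mu
    psi_h sHG aff.
  split=> //.
  + exact: chi_of_irr.
  + exact: (schur_index_chi_of p_pr pG indexZ Imu Gh Z'h DH Lpsi psi_mu psi_h).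
  split=> //.
    exact: (Ind_pair p_pr pG indexZ Imu Gh Z'h DH Lpsi psi_mu).
  exact: (same_charfield_pair p_pr pG indexZ Imu Gh DH Lpsi psi_mu psi_h).
- have [h [Gh Z'h _ _ lstP]] := listedP mu Imu.
  case/lstP=> DH Lpsi psi_mu psi_h.
  have aff := charfield_mul_repr_affords Lpsi.
  exists _, (charfield_mul_repr Lpsi); rewrite Omega_lin //; split=> //.
  exact: orbit_sum_irreducible (lin_char_irr Lpsi) aff.
- have [h [Gh Z'h _ _ lstP]] := listedP mu Imu.
  case/lstP=> DH Lpsi psi_mu psi_h _ aff; split.
  + exact: (induced_irreducible p_pr pG indexZ Imu Gh Z'h DH Lpsi psi_mu psi_h
      sHG aff).
  + exact: (induced_rker p_pr pG indexZ Imu Gh Z'h DH Lpsi psi_mu psi_h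
      sHG aff).
  exact: (induced_affords p_pr pG indexZ Imu Gh Z'h DH Lpsi psi_mu psi_h
      sHG aff).
pose phi := cfRepr (map_repr (@ratr algC) rG).
have Nphi: phi \is a character by apply: cfRepr_char.
have [i phi_i nker_i]: exists2 i, i \in irr_constt phi
    & ~~ (G^`(1)%g \subset cfker 'chi_i).
  apply/exists_inP; apply: contraNT nker => /exists_inPn ker_i.
  rewrite -(rker_map (@ratr algC)) -cfker_repr -/phi cfkerE // subsetI der_sub.
  by apply/bigcapsP=> i /ker_i; rewrite negbK.
have [mu Imu Di] := nonlinear_irr_chi_of p_pr pG indexZ nker_i.
exists mu => // H psi sHG m Psi lst irrPsi aff.
have [h [Gh Z'h _ _ lstP]] := listedP mu Imu.
case/lstP: lst => DH Lpsi psi_mu psi_h.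
have aff_chi := induced_affords p_pr pG indexZ Imu Gh Z'h DH Lpsi psi_mu
  psi_h sHG aff.
have irr_ind := induced_irreducible p_pr pG indexZ Imu Gh Z'h DH Lpsi psi_mu
  psi_h sHG aff.
apply: affords_rsim irrG irr_ind (erefl _) aff_chi _.
rewrite (Omega_chi_of p_pr pG indexZ Imu Gh Z'h DH Lpsi psi_mu psi_h) -Di.
have [theta Ntheta ->] := orbit_sum_split (mem_irr i).
rewrite -/phi cfdotDr; move: phi_i; rewrite irr_consttE.
have /natrP[k ->] := Cnat_cfdot_char_irr i Nphi.
have /natrP[l ->] := Cnat_cfdot_char Nphi Ntheta.
by rewrite -natrD !pnatr_eq0 addn_eq0 => /negPf->.
Qed.

(** * Groups generated by two elements and a central set *)

Local Open Scope group_scope.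

Section TwoGenerators.

Variables (p : nat) (gT : finGroupType) (G Z0 : {group gT}) (x y : gT).
Hypotheses (p_pr : prime p) (nabG : ~~ abelian G) (sZ0 : Z0 \subset 'Z(G)).
Hypotheses (Gx : x \in G) (Gy : y \in G).
Hypothesis genG : G \subset <[x]> <*> <[y]> <*> Z0.

Lemma two_generators_eq : <[x]> <*> <[y]> <*> Z0 = G.
Proof.
apply/eqP; rewrite eqEsubset genG andbT !join_subG !cycle_subG Gx Gy.
exact: subset_trans sZ0 (center_sub G).
Qed.

Lemma two_generators_cent : Z0 \subset 'C(<[x]> <*> <[y]>).
Proof.
apply: subset_trans sZ0 _; apply: subset_trans (subsetIr _ _) _.
by apply: centS; rewrite join_subG !cycle_subG Gx.
Qed.

(** G is a central product of <x, y> and the abelian group Z0, and [x, y] is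
    central. *)
Lemma two_generators_der1 : [~ x, y] \in Z0 -> G^`(1) = <[[~ x, y]]>.
Proof.
move=> Z0c; have defG : (<[x]> <*> <[y]>) \* Z0 = G.
  by rewrite cprodEY ?two_generators_cent ?two_generators_eq.
have abZ0: abelian Z0 by apply: abelianS sZ0 (center_abelian G).
have := der_cprod 1 defG; rewrite (derG1P abZ0) cprodg1 => <-.
apply: der1_joing_cycles; exact: subsetP two_generators_cent _ Z0c.
Qed.

Lemma two_generators_comm : [~ x, y] \in Z0 -> ~ commute x y.
Proof.
move=> Z0c /commgP c1; case/negP: nabG; apply/derG1P.
by rewrite two_generators_der1 // (eqP c1) cycle1.
Qed.

(** G / Z0 is generated by two commuting elements of order dividing p, so
    |G : Z0| divides p^2; on the other hand G / 'Z(G) is not cyclic. *)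
Lemma two_generators_center :
    [~ x, y] \in Z0 -> x ^+ p \in Z0 -> y ^+ p \in Z0 ->
  'Z(G) = Z0 /\ #|G : 'Z(G)| = (p ^ 2)%N.
Proof.
move=> Z0c Z0xp Z0yp.
have nZ0: Z0 <| G by apply: sub_center_normal.
have nZ0G := normal_norm nZ0.
have [Nx Ny] := (subsetP nZ0G x Gx, subsetP nZ0G y Gy).
have quoG : G / Z0 = <[coset Z0 x]> * <[coset Z0 y]>.
  rewrite -two_generators_eq quotientYidr; last first.
    by rewrite join_subG !cycle_subG Nx.
  have cXY: <[coset Z0 y]> \subset 'C(<[coset Z0 x]>).
    rewrite cycle_subG /= cent_cycle; apply/cent1P/esym/commgP.
    by rewrite -morphR //= coset_id.
  by rewrite quotientY ?cycle_subG // !quotient_cycle // cent_joinEr.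
have dvd_p z : z \in 'N(Z0) -> z ^+ p \in Z0 -> (#[coset Z0 z] %| p)%N.
  by move=> Nz Z0zp; rewrite order_dvdn -morphX //= coset_id.
have iG_dvd: (#|G : Z0| %| p ^ 2)%N.
  rewrite -card_quotient // quoG (dvdn_trans (dvdn_cardMg _ _)) //.
  by rewrite expnS expn1 dvdn_mul ?dvd_p.
have iZ_dvd: (#|G : 'Z(G)| %| p ^ 2)%N.
  by apply: dvdn_trans iG_dvd; apply: indexgS.
have iZ: #|G : 'Z(G)| = (p ^ 2)%N.
  have /(dvdn_pfactor _ _ p_pr)[m le_m2 Dm] := iZ_dvd.
  rewrite Dm; case: m le_m2 Dm => [|[|[|//]]] _ Dm //; case/negP: nabG.
    by move/eqP: Dm; rewrite indexg_eq1 => /abelianS->; rewrite ?center_abelian.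
  apply/cyclic_center_factor_abelian/prime_cyclic.
  by rewrite card_quotient ?normal_norm ?center_normal // Dm expn1.
split=> //; apply/esym/eqP; rewrite eqEcard sZ0 /=.
have sZ0G := normal_sub nZ0.
have: (#|G : Z0| <= #|G : 'Z(G)|)%N.
  by rewrite iZ dvdn_leq ?expn_gt0 ?prime_gt0.
rewrite -(leq_pmul2l (cardG_gt0 Z0)) Lagrange //.
by rewrite -(Lagrange (center_sub G)) leq_pmul2r.
Qed.

End TwoGenerators.

Lemma gen_center (gT : finGroupType) (S : {set gT}) (z : gT) :
  z \in <<S>> -> {in S, forall s, commute z s} -> z \in 'Z(<<S>>).
Proof.
by move=> Sz cSz; rewrite inE Sz cent_gen; apply/centP.
Qed.

Lemma lin_char_gen_eq (gT : finGroupType) (H Z : {group gT}) (A : {set gT})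
    (psi : 'CF(H)) (mu : 'CF(Z)) :
    psi \is a linear_char -> mu \is a linear_char -> Z \subset H ->
    Z = <<A>> :> {set gT} -> {in A, psi =1 mu} ->
  {in Z, psi =1 mu}.
Proof.
move=> Lpsi Lmu sZH defZ eqA.
pose B := [set z in Z | psi z == mu z].
have gB: group_set B.
  apply/group_setP; split; first by rewrite inE group1 !lin_char1 ?eqxx.
  move=> u v /setIdP[Zu /eqP eq_u] /setIdP[Zv /eqP eq_v]; rewrite inE groupM //.
  by rewrite !lin_charM ?(subsetP sZH u) ?(subsetP sZH v) ?eq_u ?eq_v /=.
have /subsetP sZB: Z \subset Group gB.
  rewrite defZ gen_subG; apply/subsetP=> z Az; rewrite inE eqA ?eqxx //.
  by rewrite defZ mem_gen.
by move=> z /sZB/setIdP[_ /eqP].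
Qed.

Lemma joing_gen_cycle (gT : finGroupType) (A : {set gT}) (h : gT) :
  <<A>> <*> <[h]> = <<h |: A>>.
Proof. by rewrite joing_idl joing_idr joingC. Qed.

(** The families prescribe H and psi on generators; this passes to the whole
    centre. *)
Lemma pair_gens (gT : finGroupType) (G : {group gT}) (A : {set gT}) (h : gT)
    (mu : 'CF('Z(G))) (H : {group gT}) (psi : 'CF(H)) :
    mu \is a linear_char -> 'Z(G) = <<A>> ->
  [/\ H = <<h |: A>> :> {set gT}, psi \is a linear_char, {in A, psi =1 mu}
    & psi h = 1%R] <->
  [/\ H = 'Z(G) <*> <[h]> :> {set gT}, psi \is a linear_char,
      {in 'Z(G), psi =1 mu} & psi h = 1%R].
Proof.
move=> Lmu defZ; rewrite -joing_gen_cycle -defZ.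
split=> [] [defH Lpsi eq_mu psi_h]; split=> //.
  by apply: lin_char_gen_eq defZ eq_mu; rewrite // defH joing_subl.
by move=> z Az; apply: eq_mu; rewrite defZ mem_gen.
Qed.

Lemma in_set1_eq (T : finType) (R : Type) (u : T) (f g : T -> R) :
  {in [set u], f =1 g} <-> f u = g u.
Proof. by split=> [-> | eq_u z /set1P->]; rewrite ?set11. Qed.

Lemma in_set2_eq (T : finType) (R : Type) (u v : T) (f g : T -> R) :
  {in [set u; v], f =1 g} <-> f u = g u /\ f v = g v.
Proof.
split=> [eq_fg | [eq_u eq_v] z /set2P[] -> //].
by rewrite !eq_fg ?set21 ?set22.
Qed.

Lemma commute_comm_pow (gT : finGroupType) (n : nat) (x y : gT) :
  commute y [~ x, y] -> [~ x, y] ^+ n = 1 -> commute x (y ^+ n).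
Proof. by move=> cyz zn; apply/commgP/eqP; rewrite commgX. Qed.

Lemma commute_pow_comm (gT : finGroupType) (n : nat) (x y : gT) :
  commute x [~ x, y] -> [~ x, y] ^+ n = 1 -> commute (x ^+ n) y.
Proof. by move=> cxz zn; apply/commgP/eqP; rewrite commXg. Qed.

Section CentralGenerators.

Variables (p : nat) (gT : finGroupType) (G : {group gT}).
Variables (A : {set gT}) (x y : gT).
Hypotheses (p_pr : prime p) (oG : #|G| = (p ^ 4)%N) (nabG : ~~ abelian G).
Hypotheses (Gx : x \in G) (Gy : y \in G) (sAZ : A \subset 'Z(G)).
(* Generation of G by x, y and A, in the form that is checked directly on the
   generators of a presentation. *)
Hypothesis genG : forall W : {group gT},
  x \in W -> y \in W -> A \subset W -> G \subset W.
Hypotheses (Ac : [~ x, y] \in <<A>>).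
Hypotheses (Axp : x ^+ p \in <<A>>) (Ayp : y ^+ p \in <<A>>).

Let sA_Z : <<A>> \subset 'Z(G).
Proof. by rewrite gen_subG. Qed.

Let sGW : G \subset <[x]> <*> <[y]> <*> <<A>>.
Proof.
apply: genG.
- by apply: (subsetP (joing_subl _ _)); rewrite mem_gen // inE cycle_id.
- by apply: (subsetP (joing_subl _ _)); rewrite mem_gen // inE cycle_id orbT.
by apply: subset_trans (joing_subr _ _); apply: subset_gen.
Qed.

Lemma central_gens_center : 'Z(G) = <<A>> /\ #|G : 'Z(G)| = (p ^ 2)%N.
Proof. exact: (two_generators_center p_pr nabG sA_Z Gx Gy sGW). Qed.

Lemma central_gens_der1 : G^`(1) = <[[~ x, y]]>.
Proof. exact: (two_generators_der1 sA_Z Gx Gy sGW Ac). Qed.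

Lemma central_gens_noncomm : ~ commute x y.
Proof. exact: (two_generators_comm nabG sA_Z Gx Gy sGW Ac). Qed.

Lemma pgroup_p4 : p.-group G.
Proof. by rewrite /pgroup oG pnatX pnat_id. Qed.

(** In five families the element h of the criterion is the generator x, whatever
    mu is. *)
Lemma central_gens_pairs
    (listed : 'CF('Z(G)) -> forall H : {group gT}, 'CF(H) -> Prop) :
    x ^+ p = 1 ->
    (forall mu (H : {group gT}) (psi : 'CF(H)), listed mu H psi <->
      [/\ H = <<x |: A>> :> {set gT}, psi \is a linear_char,
         {in A, psi =1 mu} & psi x = 1%R]) ->
  pairs_determine_irreps p listed.
Proof.
move=> xp1 listedP; have [defZ iZ] := central_gens_center.
apply: (pairs_determine_irreps_of p_pr pgroup_p4 iZ) => mu Imu.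
have Lmu := irrZ_lin Imu; exists x; split=> //.
- apply/negP=> /setIP[_ /centP cxG]; apply: central_gens_noncomm.
  exact: cxG.
- by rewrite xp1.
- by rewrite xp1 lin_char1.
move=> H psi; rewrite listedP; exact: pair_gens.
Qed.

End CentralGenerators.

(** * The six families *)

Fixpoint formula_holds (gT : finGroupType) (e : seq gT)
    (f : Presentation.formula) : bool :=
  match f with
  | Presentation.Eq2 s t => Presentation.eval e s == Presentation.eval e t
  | Presentation.And f1 f2 => formula_holds e f1 && formula_holds e f2
  end.

(** [Presentation.rel] merges the relations into one equality between nested
    tuples; here they are kept as a conjunction, ready to be used one by one. *)
Fixpoint relations_hold (gT : finGroupType) (s : seq gT) (n : nat)
    (q : Presentation.type) : bool :=
  match q with
  | Presentation.Formula f => formula_holds s f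
  | Presentation.Generator q' =>
      relations_hold s n.+1 (q' (Presentation.Cst n))
  end.

Lemma rel_formula_holds (gT : finGroupType) (e : seq gT) f r :
  (Presentation.rel e f r : bool) = formula_holds e f && (r : bool).
Proof.
elim: f r => [s t | f1 IH1 f2 IH2] r /=; last by rewrite IH1 IH2 andbA.
by case: r => /= [|vT v1 v2]; rewrite ?andbT.
Qed.

Lemma satisfies_relations (gT : finGroupType) (s : seq gT) n q :
  satisfies s n q -> relations_hold s n q.
Proof.
elim: q n => [q' IHq | f] n /=; first exact: IHq.
by rewrite rel_formula_holds => /andP[_ /andP[]].
Qed.

Ltac solve_commute :=
  repeat first [ done | exact: commute_refl | apply: commuteX
    | assumption | apply: commute_sym; assumption
    | apply: commute_sym; apply: commuteX ].

Lemma presents_Phi2_211a (p : nat) (gT : finGroupType) (G : {group gT})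
    (a a1 a2 a3 : gT) :
    prime p -> #|G| = (p ^ 4)%N -> ~~ abelian G ->
  presents G (Phi2_211a p) [:: a; a1; a2; a3] ->
    [/\ 'Z(G) = <<[set a ^+ p; a3]>>, G^`(1) = <[a ^+ p]>
      & pairs_determine_irreps p
          (fun (mu : 'CF('Z(G))) (H : {group gT}) (psi : 'CF(H)) =>
            [/\ H = <<[set a ^+ p; a1; a3]>> :> {set gT},
                psi \is a linear_char,
                psi (a ^+ p) = mu (a ^+ p), psi a1 = 1%R
              & psi a3 = mu a3])].
Proof.
move=> p_pr oG nabG [_ defG /satisfies_relations/=]; rewrite -?andbA.
case/and5P=> /eqP Da2 /eqP Dap /eqP a1p /eqP a2p.
case/and5P=> /eqP a3p /commgP c02 /commgP c03 /commgP c12.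
case/andP=> /commgP c13 /commgP c23.
have memG z : z \in [:: a; a1; a2; a3] -> z \in G.
  by move=> Sz; rewrite -defG mem_gen // inE.
have [Ga Ga1 Ga2 Ga3]: [/\ a \in G, a1 \in G, a2 \in G & a3 \in G].
  by split; apply: memG; rewrite !inE eqxx ?orbT.
pose A := [set a ^+ p; a3].
have sAZ: A \subset 'Z(G).
  rewrite -defG; apply/subsetP=> z Az; apply: gen_center.
    by rewrite defG; case/set2P: Az => ->; rewrite ?groupX.
  move=> s; rewrite !inE; case/set2P: Az => ->; rewrite ?Dap.
    by case/or4P=> /eqP->; solve_commute.
  by case/or4P=> /eqP->; solve_commute.
have genG (W : {group gT}) :
  a1 \in W -> a \in W -> A \subset W -> G \subset W.
  move=> Wa1 Wa /subsetP WA; rewrite -defG gen_subG; apply/subsetP=> z.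
  rewrite !inE => /or4P[] /eqP-> //; last by rewrite WA ?set22.
  by rewrite -Dap groupX.
have Aap: a ^+ p \in <<A>> by rewrite mem_gen ?set21.
have Ac: [~ a1, a] \in <<A>> by rewrite Da2 -Dap.
have Aa1p: a1 ^+ p \in <<A>> by rewrite a1p.
have [defZ _] := central_gens_center p_pr nabG Ga1 Ga sAZ genG Ac Aa1p Aap.
split=> //.
  by rewrite (central_gens_der1 Ga1 Ga sAZ genG Ac) Da2 Dap.
apply: (central_gens_pairs p_pr oG nabG Ga1 Ga sAZ genG Ac Aa1p Aap a1p).
move=> mu H psi.
have ->: [set a ^+ p; a1; a3] = a1 |: A by rewrite -setUA setUCA.
split=> [[? ? ? ? ?] | [? ? /in_set2_eq[? ?] ?]]; split=> //.
exact/in_set2_eq.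
Qed.

Lemma presents_Phi2_1111 (p : nat) (gT : finGroupType) (G : {group gT})
    (a a1 a2 a3 : gT) :
    prime p -> #|G| = (p ^ 4)%N -> ~~ abelian G ->
  presents G (Phi2_1111 p) [:: a; a1; a2; a3] ->
    [/\ 'Z(G) = <<[set a2; a3]>>, G^`(1) = <[a2]>
      & pairs_determine_irreps p
          (fun (mu : 'CF('Z(G))) (H : {group gT}) (psi : 'CF(H)) =>
            [/\ H = <<[set a; a2; a3]>> :> {set gT},
                psi \is a linear_char,
                psi a = 1%R, psi a2 = mu a2
              & psi a3 = mu a3])].
Proof.
move=> p_pr oG nabG [_ defG /satisfies_relations/=]; rewrite -?andbA.
case/and5P=> /eqP Da2 /eqP ap /eqP a1p /eqP a2p.
case/and5P=> /eqP a3p /commgP c02 /commgP c03 /commgP c12.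
case/andP=> /commgP c13 /commgP c23.
have memG z : z \in [:: a; a1; a2; a3] -> z \in G.
  by move=> Sz; rewrite -defG mem_gen // inE.
have [Ga Ga1 Ga2 Ga3]: [/\ a \in G, a1 \in G, a2 \in G & a3 \in G].
  by split; apply: memG; rewrite !inE eqxx ?orbT.
pose A := [set a2; a3].
have sAZ: A \subset 'Z(G).
  rewrite -defG; apply/subsetP=> z Az; apply: gen_center.
    by rewrite defG; case/set2P: Az => ->.
  move=> s; rewrite !inE; case/set2P: Az => ->.
    by case/or4P=> /eqP->; solve_commute.
  by case/or4P=> /eqP->; solve_commute.
have genG (W : {group gT}) :
  a \in W -> a1 \in W -> A \subset W -> G \subset W.
  move=> Wa Wa1 /subsetP WA; rewrite -defG gen_subG; apply/subsetP=> z.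
  by rewrite !inE => /or4P[] /eqP-> //; rewrite WA ?set21 ?set22.
(* The listed subgroup is generated by 'Z(G) and a, so the roles of a and a1
   are exchanged with respect to the other families. *)
have Da2' : [~ a, a1] = a2^-1 by rewrite -invg_comm Da2.
have Ac: [~ a, a1] \in <<A>> by rewrite Da2' groupV mem_gen ?set21.
have Aap: a ^+ p \in <<A>> by rewrite ap.
have Aa1p: a1 ^+ p \in <<A>> by rewrite a1p.
have [defZ _] := central_gens_center p_pr nabG Ga Ga1 sAZ genG Ac Aap Aa1p.
split=> //.
  by rewrite (central_gens_der1 Ga Ga1 sAZ genG Ac) Da2' cycleV.
apply: (central_gens_pairs p_pr oG nabG Ga Ga1 sAZ genG Ac Aap Aa1p ap).
move=> mu H psi; have ->: [set a; a2; a3] = a |: A by rewrite -setUA.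
split=> [[? ? ? ? ?] | [? ? /in_set2_eq[? ?] ?]]; split=> //.
exact/in_set2_eq.
Qed.

Lemma presents_Phi2_31 (p : nat) (gT : finGroupType) (G : {group gT})
    (a a1 a2 : gT) :
    prime p -> #|G| = (p ^ 4)%N -> ~~ abelian G ->
  presents G (Phi2_31 p) [:: a; a1; a2] ->
    [/\ 'Z(G) = <[a ^+ p]>, G^`(1) = <[a ^+ (p ^ 2)%N]>
      & pairs_determine_irreps p
          (fun (mu : 'CF('Z(G))) (H : {group gT}) (psi : 'CF(H)) =>
            [/\ H = <<[set a ^+ p; a1]>> :> {set gT},
                psi \is a linear_char,
                psi (a ^+ p) = mu (a ^+ p)
              & psi a1 = 1%R])].
Proof.
move=> p_pr oG nabG [_ defG /satisfies_relations/=]; rewrite -?andbA.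
case/and5P=> /eqP Da2 /eqP Dapp /eqP a1p /eqP a2p.
case/andP=> /commgP c02 /commgP c12.
have memG z : z \in [:: a; a1; a2] -> z \in G.
  by move=> Sz; rewrite -defG mem_gen // inE.
have [Ga Ga1 Ga2]: [/\ a \in G, a1 \in G & a2 \in G].
  by split; apply: memG; rewrite !inE eqxx ?orbT.
have c1ap: commute a1 (a ^+ p) by apply: commute_comm_pow; rewrite Da2.
pose A := [set a ^+ p].
have sAZ: A \subset 'Z(G).
  rewrite -defG; apply/subsetP=> z Az; apply: gen_center.
    by rewrite defG; case/set1P: Az => ->; rewrite groupX.
  move=> s; rewrite !inE; case/set1P: Az => ->.
  by case/or3P=> /eqP->; solve_commute.
have Aap: a ^+ p \in <<A>> by rewrite mem_gen ?set11.
have AWa2 (W : {group gT}) : a ^+ p \in W -> a2 \in W.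
  by move=> Wap; rewrite -Dapp expnS expn1 expgM groupX.
have genG (W : {group gT}) :
  a1 \in W -> a \in W -> A \subset W -> G \subset W.
  move=> Wa1 Wa _; rewrite -defG gen_subG; apply/subsetP=> z.
  by rewrite !inE => /or3P[] /eqP-> //; rewrite AWa2 ?groupX.
have Ac: [~ a1, a] \in <<A>> by rewrite Da2 AWa2.
have Aa1p: a1 ^+ p \in <<A>> by rewrite a1p.
have [defZ _] := central_gens_center p_pr nabG Ga1 Ga sAZ genG Ac Aa1p Aap.
split=> //.
  by rewrite (central_gens_der1 Ga1 Ga sAZ genG Ac) Da2 Dapp.
apply: (central_gens_pairs p_pr oG nabG Ga1 Ga sAZ genG Ac Aa1p Aap a1p).
move=> mu H psi; have ->: [set a ^+ p; a1] = a1 |: A by rewrite setUC.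
by split=> [[? ? ? ?] | [? ? /in_set1_eq ? ?]]; split=> //; apply/in_set1_eq.
Qed.

Lemma presents_Phi2_211b (p : nat) (gT : finGroupType) (G : {group gT})
    (a a1 a2 c : gT) :
    prime p -> #|G| = (p ^ 4)%N -> ~~ abelian G ->
  presents G (Phi2_211b p) [:: a; a1; a2; c] ->
    [/\ 'Z(G) = <[c]>, G^`(1) = <[c ^+ p]>
      & pairs_determine_irreps p
          (fun (mu : 'CF('Z(G))) (H : {group gT}) (psi : 'CF(H)) =>
            [/\ H = <<[set a1; c]>> :> {set gT},
                psi \is a linear_char,
                psi a1 = 1%R
              & psi c = mu c])].
Proof.
move=> p_pr oG nabG [_ defG /satisfies_relations/=]; rewrite -?andbA.
case/and5P=> /eqP Da2 /eqP Dcp /eqP ap /eqP a1p.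
case/and5P=> /eqP a2p /commgP c02 /commgP c03 /commgP c12.
case/andP=> /commgP c13 /commgP c23.
have memG z : z \in [:: a; a1; a2; c] -> z \in G.
  by move=> Sz; rewrite -defG mem_gen // inE.
have [Ga Ga1 Ga2 Gc]: [/\ a \in G, a1 \in G, a2 \in G & c \in G].
  by split; apply: memG; rewrite !inE eqxx ?orbT.
pose A := [set c].
have sAZ: A \subset 'Z(G).
  rewrite -defG; apply/subsetP=> z Az; apply: gen_center.
    by rewrite defG; case/set1P: Az => ->.
  move=> s; rewrite !inE; case/set1P: Az => ->.
  by case/or4P=> /eqP->; solve_commute.
have Ac: [~ a1, a] \in <<A>> by rewrite Da2 -Dcp groupX ?mem_gen ?set11.
have genG (W : {group gT}) :
  a1 \in W -> a \in W -> A \subset W -> G \subset W.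
  move=> Wa1 Wa /subsetP WA; rewrite -defG gen_subG; apply/subsetP=> z.
  have Wc: c \in W by rewrite WA ?set11.
  by rewrite !inE => /or4P[] /eqP-> //; rewrite -Dcp groupX.
have Aap: a ^+ p \in <<A>> by rewrite ap.
have Aa1p: a1 ^+ p \in <<A>> by rewrite a1p.
have [defZ _] := central_gens_center p_pr nabG Ga1 Ga sAZ genG Ac Aa1p Aap.
split=> //.
  by rewrite (central_gens_der1 Ga1 Ga sAZ genG Ac) Da2 Dcp.
apply: (central_gens_pairs p_pr oG nabG Ga1 Ga sAZ genG Ac Aa1p Aap a1p).
move=> mu H psi.
by split=> [[? ? ? ?] | [? ? /in_set1_eq ? ?]]; split=> //; apply/in_set1_eq.
Qed.

Lemma presents_Phi2_211c (p : nat) (gT : finGroupType) (G : {group gT})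
    (a a1 a2 : gT) :
    prime p -> #|G| = (p ^ 4)%N -> ~~ abelian G ->
  presents G (Phi2_211c p) [:: a; a1; a2] ->
    [/\ 'Z(G) = <<[set a ^+ p; a2]>>, G^`(1) = <[a2]>
      & pairs_determine_irreps p
          (fun (mu : 'CF('Z(G))) (H : {group gT}) (psi : 'CF(H)) =>
            [/\ H = <<[set a ^+ p; a1; a2]>> :> {set gT},
                psi \is a linear_char,
                psi (a ^+ p) = mu (a ^+ p), psi a1 = 1%R
              & psi a2 = mu a2])].
Proof.
move=> p_pr oG nabG [_ defG /satisfies_relations/=]; rewrite -?andbA.
case/and5P=> /eqP Da2 /eqP app /eqP a1p /eqP a2p.
case/andP=> /commgP c02 /commgP c12.
have memG z : z \in [:: a; a1; a2] -> z \in G.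
  by move=> Sz; rewrite -defG mem_gen // inE.
have [Ga Ga1 Ga2]: [/\ a \in G, a1 \in G & a2 \in G].
  by split; apply: memG; rewrite !inE eqxx ?orbT.
have c1ap: commute a1 (a ^+ p) by apply: commute_comm_pow; rewrite Da2.
pose A := [set a ^+ p; a2].
have sAZ: A \subset 'Z(G).
  rewrite -defG; apply/subsetP=> z Az; apply: gen_center.
    by rewrite defG; case/set2P: Az => ->; rewrite ?groupX.
  move=> s; rewrite !inE; case/set2P: Az => ->.
    by case/or3P=> /eqP->; solve_commute.
  by case/or3P=> /eqP->; solve_commute.
have Aap: a ^+ p \in <<A>> by rewrite mem_gen ?set21.
have genG (W : {group gT}) :
  a1 \in W -> a \in W -> A \subset W -> G \subset W.
  move=> Wa1 Wa /subsetP WA; rewrite -defG gen_subG; apply/subsetP=> z.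
  by rewrite !inE => /or3P[] /eqP-> //; rewrite WA ?set22.
have Ac: [~ a1, a] \in <<A>> by rewrite Da2 mem_gen ?set22.
have Aa1p: a1 ^+ p \in <<A>> by rewrite a1p.
have [defZ _] := central_gens_center p_pr nabG Ga1 Ga sAZ genG Ac Aa1p Aap.
split=> //.
  by rewrite (central_gens_der1 Ga1 Ga sAZ genG Ac) Da2.
apply: (central_gens_pairs p_pr oG nabG Ga1 Ga sAZ genG Ac Aa1p Aap a1p).
move=> mu H psi.
have ->: [set a ^+ p; a1; a2] = a1 |: A by rewrite -setUA setUCA.
split=> [[? ? ? ? ?] | [? ? /in_set2_eq[? ?] ?]]; split=> //.
exact/in_set2_eq.
Qed.

(** z is a primitive p-th root of unity because p is prime. *)
Lemma exp_root_uniq (p : nat) (z w : algC) :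
    prime p -> (z ^+ p = 1)%R -> (w ^+ p = 1)%R -> z != 1%R ->
  exists! i : nat, (i < p)%N /\ w = (z ^+ i)%R.
Proof.
move=> p_pr zp1 wp1 nz1.
have [m prim_m] := prim_order_exists (prime_gt0 p_pr) zp1.
case/primeP: (p_pr) => _ dvd_p /dvd_p/orP[] /eqP Dm; rewrite {m}Dm in prim_m.
  by rewrite -(prim_expr_order prim_m) expr1 eqxx in nz1.
have [i Dw] := prim_rootP prim_m wp1.
exists i; split=> [|j [lt_jp Dj]]; first by split.
have/eqP: (z ^+ i = z ^+ j)%R by rewrite -Dw.
by rewrite (eq_prim_root_expr prim_m) !modn_small // => /eqP.
Qed.

Lemma presents_Phi2_22 (p : nat) (gT : finGroupType) (G : {group gT})
    (a a1 a2 : gT) :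
    prime p -> odd p -> #|G| = (p ^ 4)%N -> ~~ abelian G ->
  presents G (Phi2_22 p) [:: a; a1; a2] ->
    [/\ 'Z(G) = <<[set a ^+ p; a1 ^+ p]>>, G^`(1) = <[a ^+ p]>,
        forall mu : 'CF('Z(G)), irrZ_over_der mu ->
          exists! i : nat, (i < p)%N
            /\ mu (a1 ^+ p) = (mu (a ^+ p)%g ^+ i)%R
      & pairs_determine_irreps p
          (fun (mu : 'CF('Z(G))) (H : {group gT}) (psi : 'CF(H)) =>
            exists2 i : nat,
              (i < p)%N /\ mu (a1 ^+ p) = (mu (a ^+ p)%g ^+ i)%R
            & [/\ H = <<[set a ^- i * a1; a ^+ p]>> :> {set gT},
                  psi \is a linear_char,
                  psi (a ^- i * a1) = 1%R
                & psi (a ^+ p) = mu (a ^+ p)])].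
Proof.
move=> p_pr p_odd oG nabG [_ defG /satisfies_relations/=]; rewrite -?andbA.
case/and5P=> /eqP Da2 /eqP Dap /eqP a1pp /eqP a2p.
case/andP=> /commgP c02 /commgP c12.
have memG z : z \in [:: a; a1; a2] -> z \in G.
  by move=> Sz; rewrite -defG mem_gen // inE.
have [Ga Ga1 Ga2]: [/\ a \in G, a1 \in G & a2 \in G].
  by split; apply: memG; rewrite !inE eqxx ?orbT.
have ca1p: commute (a1 ^+ p) a by apply: commute_pow_comm; rewrite Da2.
pose A := [set a ^+ p; a1 ^+ p].
have sAZ: A \subset 'Z(G).
  rewrite -defG; apply/subsetP=> z Az; apply: gen_center.
    by rewrite defG; case/set2P: Az => ->; rewrite ?groupX.
  move=> s; rewrite !inE; case/set2P: Az => ->; rewrite ?Dap.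
    by case/or3P=> /eqP->; solve_commute.
  by case/or3P=> /eqP->; solve_commute.
have genG (W : {group gT}) :
  a1 \in W -> a \in W -> A \subset W -> G \subset W.
  move=> Wa1 Wa /subsetP WA; rewrite -defG gen_subG; apply/subsetP=> z.
  by rewrite !inE => /or3P[] /eqP-> //; rewrite -Dap groupX.
have Aap: a ^+ p \in <<A>> by rewrite mem_gen ?set21.
have Ac: [~ a1, a] \in <<A>> by rewrite Da2 -Dap.
have Aa1p: a1 ^+ p \in <<A>> by rewrite mem_gen ?set22.
have [defZ iZ] := central_gens_center p_pr nabG Ga1 Ga sAZ genG Ac Aa1p Aap.
have pG := pgroup_p4 p_pr oG.
have defG': G^`(1) = <[a ^+ p]>.
  by rewrite (central_gens_der1 Ga1 Ga sAZ genG Ac) Da2 Dap.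
have [Zap Za1p]: a ^+ p \in 'Z(G) /\ a1 ^+ p \in 'Z(G).
  by rewrite defZ Aap Aa1p.
have exp_mu (mu : 'CF('Z(G))) : irrZ_over_der mu ->
  exists! i : nat, (i < p)%N /\ mu (a1 ^+ p) = (mu (a ^+ p)%g ^+ i)%R.
- move=> Imu; have Lmu := irrZ_lin Imu; apply: exp_root_uniq => //.
  + by rewrite -lin_charX // Dap a2p lin_char1.
  + by rewrite -lin_charX // -expgM mulnn a1pp lin_char1.
  case: Imu => _; apply: contraNneq => mu1.
  by rewrite defG' cycle_subG mem_cfker_char ?lin_charW // mu1 lin_char1.
(* The commutator of the factors contributes its power of exponent 'C(p, 2),
   a multiple of p as p is odd. *)
have hX i : (a ^- i * a1) ^+ p = (a ^+ p) ^- i * a1 ^+ p.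
  have ca: commute a [~ a1, a] by rewrite Da2.
  have Da2i : [~ a1, a ^- i] = a2 ^- i.
    have Dc: [~ a1, a ^+ i] = a2 ^+ i by rewrite commgX Da2.
    by rewrite commgV Dc //; apply: commuteX2.
  rewrite expMg_Rmul ?Da2i; last 2 first.
  - by apply/commuteV/commuteX.
  - by apply/commuteV/commute_sym/commuteV/commuteX/commute_sym/commuteX.
  have [m ->]: exists m, 'C(p, 2) = (p * m)%N.
    have /dvdnP[m ->]: (p %| 'C(p, 2))%N.
      by apply: prime_dvd_bin; rewrite // odd_prime_gt2.
    by exists m; rewrite mulnC.
  rewrite [X in _ * X = _](_ : _ = 1); last first.
    by rewrite expgVn -expgM mulnCA expgM a2p expg1n invg1.
  by rewrite mulg1 expgVn -!expgM mulnC.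
split=> //; apply: (pairs_determine_irreps_of p_pr pG iZ) => mu Imu.
have Lmu := irrZ_lin Imu; have [i [[lt_ip Di] uniq_i]] := exp_mu mu Imu.
pose h := a ^- i * a1; have Gh: h \in G by rewrite groupM ?groupV ?groupX.
have Zhp: h ^+ p \in 'Z(G) by rewrite hX groupM // groupV groupX.
exists h; split=> //.
- apply/negP=> /setIP[_ /centP chG].
  apply: (central_gens_noncomm nabG Ga1 Ga sAZ genG Ac).
  have -> : a1 = a ^+ i * h by rewrite /h mulKVg.
  by apply/commute_sym/commuteM; [apply: commuteX | apply/commute_sym/chG].
- have Zapi: (a ^+ p) ^+ i \in 'Z(G) by rewrite groupX.
  rewrite hX lin_charM ?groupV // lin_charV // lin_charX //.
  by rewrite Di mulVf // expf_neq0 ?lin_char_neq0.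
move=> H psi; rewrite -(pair_gens _ _ Lmu defZ) /=.
have a1pE: a1 ^+ p = (a ^+ p) ^+ i * h ^+ p by rewrite hX mulKVg.
have genH: <<h |: A>> = <<[set h; a ^+ p]>>.
  apply/eqP; rewrite eqEsubset !gen_subG; apply/andP; split; apply/subsetP=> z.
    case/setU1P=> [-> | /set2P[]->]; first by rewrite mem_gen ?set21.
      by rewrite mem_gen ?set22.
    by rewrite a1pE groupM // groupX ?mem_gen ?set21 ?set22.
  by case/set2P=> ->; rewrite mem_gen // !inE eqxx ?orbT.
rewrite genH; split=> [[j [lt_jp Dj]] | [DH Lpsi eq_mu psi_h]].
  have <- : i = j by apply: uniq_i.
  case=> DH Lpsi psi_h psi_ap; split=> //; apply/in_set2_eq; split=> //.
  have [Hh Hap]: h \in H /\ a ^+ p \in H.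
    by rewrite DH !mem_gen ?set21 ?set22.
  rewrite Di {1}a1pE (lin_charM Lpsi (groupX i Hap) (groupX p Hh)).
  rewrite (lin_charX Lpsi i Hap) (lin_charX Lpsi p Hh).
  by rewrite psi_h expr1n mulr1 psi_ap.
exists i; first by split.
by split=> //; apply: eq_mu; rewrite set21.
Qed.

Theorem theorem47 (p : nat) (gT : finGroupType) (G : {group gT})
  (p_pr : prime p) (p_odd : odd p)
  (oG : #|G| = (p ^ 4)%N) (nabG : ~~ abelian G) :
  (* (a) *)
  (forall a a1 a2 a3 : gT, presents G (Phi2_211a p) [:: a; a1; a2; a3] ->
    [/\ 'Z(G) = <<[set a ^+ p; a3]>>, G^`(1) = <[a ^+ p]>
      & pairs_determine_irreps p
          (fun (mu : 'CF('Z(G))) (H : {group gT}) (psi : 'CF(H)) =>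
            [/\ H = <<[set a ^+ p; a1; a3]>> :> {set gT},
                psi \is a linear_char,
                psi (a ^+ p) = mu (a ^+ p), psi a1 = 1%R
              & psi a3 = mu a3])]) /\
  (* (b) *)
  (forall a a1 a2 a3 : gT, presents G (Phi2_1111 p) [:: a; a1; a2; a3] ->
    [/\ 'Z(G) = <<[set a2; a3]>>, G^`(1) = <[a2]>
      & pairs_determine_irreps p
          (fun (mu : 'CF('Z(G))) (H : {group gT}) (psi : 'CF(H)) =>
            [/\ H = <<[set a; a2; a3]>> :> {set gT},
                psi \is a linear_char,
                psi a = 1%R, psi a2 = mu a2
              & psi a3 = mu a3])]) /\
  (* (c) *)
  (forall a a1 a2 : gT, presents G (Phi2_31 p) [:: a; a1; a2] ->
    [/\ 'Z(G) = <[a ^+ p]>, G^`(1) = <[a ^+ (p ^ 2)%N]>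
      & pairs_determine_irreps p
          (fun (mu : 'CF('Z(G))) (H : {group gT}) (psi : 'CF(H)) =>
            [/\ H = <<[set a ^+ p; a1]>> :> {set gT},
                psi \is a linear_char,
                psi (a ^+ p) = mu (a ^+ p)
              & psi a1 = 1%R])]) /\
  (* (d) *)
  (forall a a1 a2 : gT, presents G (Phi2_22 p) [:: a; a1; a2] ->
    [/\ 'Z(G) = <<[set a ^+ p; a1 ^+ p]>>, G^`(1) = <[a ^+ p]>,
        forall mu : 'CF('Z(G)), irrZ_over_der mu ->
          exists! i : nat, (i < p)%N
            /\ mu (a1 ^+ p) = (mu (a ^+ p)%g ^+ i)%R
      & pairs_determine_irreps p
          (fun (mu : 'CF('Z(G))) (H : {group gT}) (psi : 'CF(H)) =>
            exists2 i : nat,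
              (i < p)%N /\ mu (a1 ^+ p) = (mu (a ^+ p)%g ^+ i)%R
            & [/\ H = <<[set a ^- i * a1; a ^+ p]>> :> {set gT},
                  psi \is a linear_char,
                  psi (a ^- i * a1) = 1%R
                & psi (a ^+ p) = mu (a ^+ p)])]) /\
  (* (e) *)
  (forall a a1 a2 c : gT, presents G (Phi2_211b p) [:: a; a1; a2; c] ->
    [/\ 'Z(G) = <[c]>, G^`(1) = <[c ^+ p]>
      & pairs_determine_irreps p
          (fun (mu : 'CF('Z(G))) (H : {group gT}) (psi : 'CF(H)) =>
            [/\ H = <<[set a1; c]>> :> {set gT},
                psi \is a linear_char,
                psi a1 = 1%R
              & psi c = mu c])]) /\
  (* (f) *)
  (forall a a1 a2 : gT, presents G (Phi2_211c p) [:: a; a1; a2] ->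
    [/\ 'Z(G) = <<[set a ^+ p; a2]>>, G^`(1) = <[a2]>
      & pairs_determine_irreps p
          (fun (mu : 'CF('Z(G))) (H : {group gT}) (psi : 'CF(H)) =>
            [/\ H = <<[set a ^+ p; a1; a2]>> :> {set gT},
                psi \is a linear_char,
                psi (a ^+ p) = mu (a ^+ p), psi a1 = 1%R
              & psi a2 = mu a2])]).
Proof.
split=> [a a1 a2 a3|]; first exact: presents_Phi2_211a.
split=> [a a1 a2 a3|]; first exact: presents_Phi2_1111.
split=> [a a1 a2|]; first exact: presents_Phi2_31.
split=> [a a1 a2|]; first exact: presents_Phi2_22.
split=> [a a1 a2 c|a a1 a2]; first exact: presents_Phi2_211b.
exact: presents_Phi2_211c.
Qed.
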